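(* There are infinitely many primitive Gaussian lines $L$ for which $g_L\ge 260{,}000$.
   Context: A Gaussian line is a line in the complex plane containing at least two (hence infinitely many) Gaussian integers; it is primitive if it contains two Gaussian integers that are coprime in $\mathbb{Z}[i]$. For a Gaussian line $L$, let $\alpha_0$ be the Gaussian integer on $L$ of minimum norm $N(x+iy)=x^2+y^2$ (if there are two such, take the one with larger real part). If $L$ is vertical, set $\delta=i$; otherwise let $\alpha_1$ be the Gaussian integer on $L$ with $\mathrm{Re}(\alpha_1)>\mathrm{Re}(\alpha_0)$ that is closest to $\alpha_0$, and set $\delta=\alpha_1-\alpha_0$. Then the Gaussian integers on $L$ are exactly $\alpha_m=\alpha_0+m\delta$ for $m\in\mathbb{Z}$. A finite list of Gaussian integers has the property that ''none is coprime to all the others'' if each term shares a common non-unit divisor in $\mathbb{Z}[i]$ with some other term of the list. For a primitive Gaussian line $L$, $g_L$ denotes the smallest integer $n\ge 2$ such that there exist $n$ consecutive terms $\alpha_{k+1},\dots,\alpha_{k+n}$ of the sequence $(\alpha_0,\alpha_1,\alpha_2,\dots)$ none of which is coprime to all the others (such $n$ exists for every primitive Gaussian line). *)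

(* Defs.v *)
From HB Require Import structures.
From mathcomp Require Import all_boot all_order all_algebra.
From mathcomp Require Import complex.
From mathcomp Require Import boolp classical_sets cardinality reals.

Set Implicit Arguments.
Unset Strict Implicit.
Unset Printing Implicit Defensive.

Import Order.TTheory GRing.Theory Num.Theory.
Local Open Scope classical_set_scope.
Local Open Scope ring_scope.
Local Open Scope complex_scope.

Definition gaussian_integer (R : realType) : set R[i] :=
  [set z | complex.Re z \is a Num.int /\ complex.Im z \is a Num.int].

Definition gaussian_norm (R : realType) (z : R[i]) : R :=
  complex.Re z ^+ 2 + complex.Im z ^+ 2.

Definition gaussian_dvd (R : realType) (a b : R[i]) : Prop :=
  exists2 c, gaussian_integer c & b = c * a.

Definition gaussian_unit (R : realType) (a : R[i]) : Prop :=
  gaussian_integer a /\ exists2 b, gaussian_integer b & b * a = 1.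

Definition common_nonunit_divisor (R : realType) (a b : R[i]) : Prop :=
  exists p, [/\ gaussian_integer p, ~ gaussian_unit p,
                gaussian_dvd p a & gaussian_dvd p b].

Definition gaussian_coprime (R : realType) (a b : R[i]) : Prop :=
  ~ common_nonunit_divisor a b.

Definition is_line (R : realType) (L : set R[i]) : Prop :=
  exists p d : R[i], d != 0 /\ L = [set p + t%:C * d | t in [set: R]].

Definition gaussian_points (R : realType) (L : set R[i]) : set R[i] :=
  L `&` @gaussian_integer R.

Definition gaussian_line (R : realType) (L : set R[i]) : Prop :=
  is_line L /\
  exists a b, [/\ gaussian_points L a, gaussian_points L b & a != b].

Definition primitive_gaussian_line (R : realType) (L : set R[i]) : Prop :=
  gaussian_line L /\
  exists a b, [/\ gaussian_points L a, gaussian_points L b, a != b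
                & gaussian_coprime a b].

Definition vertical (R : realType) (L : set R[i]) : Prop :=
  forall z w, L z -> L w -> complex.Re z = complex.Re w.

(* On a Gaussian line the condition has exactly one solution, so the default
   value of xget is irrelevant; the same holds for alpha1 if L is not vertical. *)
Definition alpha0 (R : realType) (L : set R[i]) : R[i] :=
  xget 0 [set a | gaussian_points L a /\
    forall b, gaussian_points L b ->
      gaussian_norm a < gaussian_norm b \/
      gaussian_norm a = gaussian_norm b /\ complex.Re b <= complex.Re a].

Definition right_gaussian_points (R : realType) (L : set R[i]) : set R[i] :=
  [set a | gaussian_points L a /\ complex.Re (alpha0 L) < complex.Re a].

Definition alpha1 (R : realType) (L : set R[i]) : R[i] :=
  xget 0 [set a | right_gaussian_points L a /\
    forall b, right_gaussian_points L b ->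
      `|a - alpha0 L| <= `|b - alpha0 L|].

Definition delta (R : realType) (L : set R[i]) : R[i] :=
  if `[< vertical L >] then 'i else alpha1 L - alpha0 L.

Definition alpha (R : realType) (L : set R[i]) (m : nat) : R[i] :=
  alpha0 L + m%:R * delta L.

Definition none_coprime_to_all_others (R : realType) (s : seq R[i]) : Prop :=
  forall i, (i < size s)%N ->
    exists j, [/\ (j < size s)%N, j != i & common_nonunit_divisor s`_i s`_j].

(* The window alpha_k, ..., alpha_(k + n - 1), with k = 0 allowed. *)
Definition has_bad_window (R : realType) (L : set R[i]) (n : nat) : Prop :=
  exists k : nat,
    none_coprime_to_all_others (mkseq (fun i => alpha L (k + i)) n).

(* If no admissible n existed, the value would be 0: a positive lower bound on
   gL L therefore entails that the minimum is attained. *)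
Definition gL (R : realType) (L : set R[i]) : nat :=
  xget 0%N [set n | [/\ (2 <= n)%N, has_bad_window L n
    & forall m, (2 <= m)%N -> has_bad_window L m -> (n <= m)%N]].

(* Main.v *)
(** For [y] coprime to [x^2 + 1], the Gaussian integers on the line
    [Re z = y + x Im z] are the points [y + m (x + i)].  Two of them share a
    non-unit divisor iff some rational prime divides the difference of their
    indices [m] and both of their norms.

    Put [P = 260000], choose [x] with [x^2 = -1] modulo 2 and modulo every
    prime [p = 1 mod 4] up to [P], and [y] without prime factors up to [P].
    Then, among the primes up to [P], only those that are [1 mod 4] divide the
    norm of some point, and each of them does so for the indices of a single
    residue class.  A bad window of length [n < P] would therefore be an
    interval of length [n] covered by one class modulo each prime
    [p = 1 mod 4] below [n].  The class modulo 5 has at most [ceil (n / 5)]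
    elements in it, and the class modulo [p] has at most [q - floor (q / 5)]
    elements outside of the former, with [q = ceil (n / p)].  These numbers
    add up to less than [n], which is checked by computation.

    A bad window exists for suitable [x] and [y]: around a center [c], let the
    norm at index [c] be divisible by all primes up to [M] that are
    [1 mod 4] and by all those that are [3 mod 4] and exceed [P].  Then the
    point at offset [f] shares a divisor with the center unless all prime
    factors of [f] are at most [P].  There are only [O((log M)^k)] such
    offsets up to [M].  A prime [p = 1 mod 4] above [P] divides the norm for a
    second class of indices, which is free to hit any prescribed offset.  For
    infinitely many [M = 4^j] there are at least [sqrt M / 16] such primes,
    because every [k^2 + 1] is a product of 2 and of primes that are
    [1 mod 4]. *)

From Stdlib Require Import NArith.
Require Import Defs.
From mathcomp Require Import all_boot all_order all_algebra.
From mathcomp Require Import complex.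
From mathcomp Require Import boolp classical_sets cardinality reals.
From mathcomp Require Import finfield finmap zify ring.

Set Implicit Arguments.
Unset Strict Implicit.
Unset Printing Implicit Defensive.

Import Order.TTheory GRing.Theory Num.Theory.

(** * One residue class modulo each prime that is 1 modulo 4 *)

Definition split_prime (p : nat) := prime p && (p %% 4 == 1).

(** Only primes below [n] count, since a prime shared by two points of a window of length [n]
    divides the difference of their indices. *)
Definition split_cover (n : nat) (r : nat -> nat) : Prop :=
  forall i, i < n -> exists p, [/\ split_prime p, p < n & i == r p %[mod p]].

(* Erases the entries at the positions [c], [c + q], [c + 2 q], and so on. *)
Fixpoint strike (q c : nat) (l : seq bool) : seq bool :=
  match l, c with
  | [::], _ => [::]
  | _ :: l', 0 => false :: strike q q.-1 l'
  | b :: l', c'.+1 => b :: strike q c' l'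
  end.

(* Entry [j] of the sieved sequences stands for the number [4 * j + 9].  The
   pair [(q, c)] strikes out the multiples of [q] from [4 * c + 9], which is
   [3 * q] or [5 * q]. *)
Definition strides : seq (nat * nat) := [::
  (3, 0); (5, 4); (7, 3); (11, 6); (13, 14); (17, 19); (19, 12); (23, 15);
  (29, 34); (31, 21); (37, 44); (41, 49); (43, 30); (47, 33); (53, 64);
  (59, 42); (61, 74)].

(* Pairs (length of a block of consecutive entries, bound on the number of
   entries left in it by the sieve). *)
Definition blocks : seq (nat * nat) := [::
  (1, 0); (1, 1); (1, 1); (2, 0); (1, 1); (1, 0); (1, 1); (1, 1); (2, 0);
  (1, 1); (1, 0); (2, 1); (2, 1); (2, 0); (3, 1); (3, 2); (4, 2); (4, 1);
  (5, 2); (6, 2); (6, 2); (7, 2); (8, 2); (10, 4); (11, 4); (13, 5); (15, 6);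
  (17, 2); (19, 6); (22, 7); (26, 8); (30, 7); (34, 11); (39, 11); (45, 13);
  (52, 10); (60, 17); (69, 18); (79, 22); (91, 23); (104, 24); (120, 29);
  (138, 33); (159, 38); (183, 45); (210, 52); (241, 59); (278, 73); (319, 83);
  (367, 91); (422, 110); (486, 121); (558, 143); (642, 170); (738, 190);
  (849, 227); (976, 252); (1123, 300); (1291, 336); (1485, 392); (1708, 448);
  (1964, 528); (2259, 589); (2597, 691); (2987, 795); (3435, 906);
  (3950, 1049); (4543, 1210); (5224, 1378); (6008, 1595); (6909, 1832);
  (7945, 2089); (4083, 1083)].

Definition milestones : seq N := [::
  5%num; 15%num; 35%num; 69%num; 123%num; 209%num; 338%num; 533%num; 801%num;
  1183%num; 1675%num; 2353%num; 3213%num; 4245%num; 5613%num; 7345%num;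
  9420%num; 11726%num; 14643%num; 17665%num; 21281%num; 25578%num; 29957%num;
  34449%num; 39613%num; 45461%num; 51919%num; 58970%num; 66245%num; 73340%num;
  79665%num; 87906%num; 95415%num; 104318%num; 112606%num; 121153%num;
  129610%num; 138554%num; 146780%num; 156752%num; 163645%num; 172245%num;
  181795%num; 188235%num; 196305%num; 206265%num; 211889%num; 217877%num;
  225460%num; 234549%num; 242350%num; 249600%num; 258852%num; 260000%num].

(** With [strides], only factors up to 61 are struck out, so some composite numbers survive; they
    can only enlarge the bound. *)
Definition sieve (s : seq (nat * nat)) (n : nat) : seq bool :=
  foldr (fun qc => strike qc.1 qc.2) (nseq n true) s.

Fixpoint block_check (l : seq bool) (t : seq (nat * nat)) : bool :=
  if t is (len, cnt) :: t' then
    (count id (take len l) <= cnt) && block_check (drop len l) t'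
  else nilp l.

(* [a] is the number represented by the first entry of the current block, so
   that [q] bounds [ceil (n / p)] for every [p] in it. *)
Fixpoint cost (n a : N) (t : seq (nat * nat)) : N :=
  if t is (len, cnt) :: t' then
    if (n <=? a)%num then 0%num else
    let q := ((n - 1) / a + 1)%num in
    (N.of_nat cnt * (q - q / 5) + cost n (a + 4 * N.of_nat len) t')%num
  else 0%num.

(** The prime 5 precedes the sieved numbers and contributes the term [ceil (n / 5)]. No split prime
    is below a length of at most 5. *)
Definition cover_bound (t : seq (nat * nat)) (n : N) : N :=
  (if n <=? 5 then 0 else (n - 1) / 5 + 1 + cost n 9 t)%num.

(* [cover_bound t m'] bounds the number of covered elements for every length
   [n <= m'], so the comparison with [m] settles all [n] with [m < n <= m']. *)
Fixpoint milestone_check (t : seq (nat * nat)) (m : N) (s : seq N) : bool :=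
  if s is m' :: s' then (cover_bound t m' <=? m)%num && milestone_check t m' s'
  else true.

(** The 64998 entries stand for 9, 13, ..., 259997, which include every split prime below 260000
    except 5. *)
Lemma sieve_check : block_check (sieve strides 64998) blocks.
Proof. by vm_cast_no_check (erefl true). Qed.

Lemma milestones_check : milestone_check blocks 0 milestones.
Proof. by vm_cast_no_check (erefl true). Qed.

(** * Correctness of the sieve and of the covering bound *)

Lemma nth_strike q c l i : 0 < q ->
  nth false (strike q c l) i =
  nth false l i && ~~ ((c <= i) && (q %| i - c)).
Proof.
move=> q_gt0; elim: l c i => [|b l IHl] [|c] [|i] //=.
- by rewrite subnn dvdn0 andbF.
- rewrite IHl subn0; congr (_ && ~~ _).
  case: (leqP q.-1 i) => [le_qi|lt_iq] /=.
    have -> : i.+1 = i - q.-1 + q by lia.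
    by rewrite dvdn_addl.
  by rewrite gtnNdvd //; lia.
- by rewrite andbT.
- by rewrite IHl.
Qed.

(** Striking starts at a multiple of [q] greater than [q], so it only hits composite numbers. *)
Lemma nth_sieve s n j :
  all (fun qc => [&& 1 < qc.1, qc.1 < 4 * qc.2 + 9 &
                     qc.1 %| 4 * qc.2 + 9]) s ->
  j < n -> prime (4 * j + 9) -> nth false (sieve s n) j.
Proof.
move=> valid_s lt_jn pr_j; rewrite /sieve.
elim: s valid_s => [_|[q c] s IHs]; first by rewrite nth_nseq lt_jn.
move=> /= /andP[/and3P[q_gt1 lt_q dv_q] /IHs IH].
rewrite nth_strike ?(ltnW q_gt1) // IH /=; apply/negP => /andP[le_cj dv_j].
have /prime_nt_dvdP : q %| 4 * j + 9.
  have -> : 4 * j + 9 = 4 * (j - c) + (4 * c + 9) by lia.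
  by rewrite dvdn_add // dvdn_mull.
by move=> /(_ pr_j); lia.
Qed.

Fixpoint weight_sum (f : nat -> nat) (a : nat) (l : seq bool) : nat :=
  if l is b :: l' then b * f a + weight_sum f (a + 4) l' else 0.

Lemma weight_sum_cat f a l1 l2 :
  weight_sum f a (l1 ++ l2) =
  weight_sum f a l1 + weight_sum f (a + 4 * size l1) l2.
Proof.
elim: l1 a => [|b l1 IHl] a /=; first by rewrite muln0 addn0.
by rewrite IHl addnA; congr (_ + weight_sum f _ l2); lia.
Qed.

Lemma weight_sum_le f a l h : (forall p, a <= p -> f p <= h) ->
  weight_sum f a l <= count id l * h.
Proof.
elim: l a => [|b l IHl] a //= le_h; rewrite mulnDl leq_add //.
  by rewrite leq_mul // le_h.
by apply: IHl => p le_ap; apply: le_h; lia.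
Qed.

Lemma weight_sum_cost f (n : nat) l (a : nat) t :
  0 < a -> (forall p, n <= p -> f p = 0) ->
  (forall p q, n <= p * q -> f p <= q - q %/ 5) ->
  block_check l t ->
  weight_sum f a l <= N.to_nat (cost (N.of_nat n) (N.of_nat a) t).
Proof.
move=> a_gt0 f_out f_le; elim: t l a a_gt0 => [|[len cnt] t IHt] l a a_gt0.
  by case: l.
move=> /= /andP[le_cnt /IHt IH].
case: ifP => [/N.leb_spec0 le_na | /N.leb_spec0 lt_an].
  have f0 p : a <= p -> f p <= 0.
    by move=> le_ap; rewrite f_out //; lia.
  by have := weight_sum_le l f0; rewrite muln0.
rewrite -{1}(cat_take_drop len l) weight_sum_cat.
set q := ((N.of_nat n - 1) / N.of_nat a + 1)%num.
have q_spec : n <= a * N.to_nat q.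
  have := N.mod_lt (N.of_nat n - 1) (N.of_nat a) ltac:(lia).
  have := N.div_mod (N.of_nat n - 1) (N.of_nat a) ltac:(lia).
  rewrite /q; move: (N.modulo _ _) (N.div _ _) => v u /(f_equal N.to_nat).
  by rewrite N2Nat.inj_add N2Nat.inj_mul Nat2N.id => nE v_lt; lia.
have h_le p : a <= p -> f p <= N.to_nat (q - q / 5).
  move=> le_ap.
  have -> : N.to_nat (q - q / 5) = N.to_nat q - N.to_nat q %/ 5.
    have := N.mod_lt q 5 ltac:(lia); have := N.div_mod q 5 ltac:(lia).
    move: (N.modulo q 5) (N.div q 5) => v u /(f_equal N.to_nat) qE v_lt.
    have -> : N.to_nat q = u * 5 + v by lia.
    by rewrite divnMDl // divn_small; lia.
  by apply: f_le; apply: leq_trans q_spec _; rewrite leq_mul2r le_ap orbT.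
have {h_le} := weight_sum_le (take len l) h_le.
have {IH} := IH (a + 4 * len) ltac:(lia).
have -> : N.of_nat (a + 4 * len) = (N.of_nat a + 4 * N.of_nat len)%num by lia.
set rest := cost _ _ _; set h := (q - q / 5)%num.
have -> : weight_sum f (a + 4 * size (take len l)) (drop len l) =
          weight_sum f (a + 4 * len) (drop len l).
  rewrite size_take; case: ltnP => // le_l.
  by rewrite drop_oversize.
have : count id (take len l) * N.to_nat h <= cnt * N.to_nat h.
  by rewrite leq_mul2r le_cnt orbT.
rewrite N2Nat.inj_add N2Nat.inj_mul Nat2N.id.
lia.
Qed.

Lemma count_union (T : eqType) (I : Type) (P : pred T) (Q : I -> pred T) s X :
  {in s, forall x, P x -> has (Q^~ x) X} ->
  count P s <= \sum_(i <- X) count (Q i) s.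
Proof.
elim: X P => [|i X IHX] P cover.
  rewrite big_nil leqn0 -leqn0 leqNgt -has_count; apply/hasPn => x xs.
  by apply/negP => /(cover x xs).
rewrite big_cons -size_filter -(count_predC (Q i)) !count_filter leq_add //.
  by apply: sub_count => x /andP[].
apply: IHX => x xs /= /andP[/negPf nQ /(cover x xs)].
by rewrite /= nQ.
Qed.

Lemma count_class_le p r n q f : 0 < p -> n <= p * q ->
  count (fun i => (i == r %[mod p]) && f i) (iota 0 n) <=
  count (fun j => f (r %% p + p * j)) (iota 0 q).
Proof.
move=> p_gt0 le_n; rewrite -!size_filter.
rewrite -[leqRHS](size_map (fun j => r %% p + p * j)).
apply: uniq_leq_size; first by rewrite filter_uniq // iota_uniq.
move=> i; rewrite mem_filter mem_iota add0n => /andP[/andP[/eqP eq_i fi] lt_in].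
have def_i : i = r %% p + p * (i %/ p) by rewrite -eq_i addnC mulnC -divn_eq.
apply/mapP; exists (i %/ p) => //.
rewrite mem_filter -def_i fi mem_iota /= add0n ltn_divLR //; lia.
Qed.

(** Each of the [q %/ d] disjoint blocks of length [d] loses an element. *)
Lemma count_sparse m d (f : pred nat) q : 0 < d ->
  (forall a, exists2 j, a <= j < a + d & ~~ f j) ->
  count f (iota m q) <= q - q %/ d.
Proof.
move=> d_gt0 gap; elim/ltn_ind: q m => q IHq m.
case: (ltnP q d) => [lt_qd|le_dq].
  by rewrite divn_small // subn0 -[X in _ <= X](size_iota m q) count_size.
have := IHq (q - d) ltac:(lia) (m + d).
have -> : iota m q = iota m d ++ iota (m + d) (q - d).
  by rewrite -iotaD subnKC.
have -> : q %/ d = (q - d) %/ d + 1.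
  by rewrite -{1}(subnK le_dq) divnDr // divnn d_gt0.
rewrite count_cat; have [j le_j nfj] := gap m.
have : count f (iota m d) < d.
  rewrite -[X in _ < X](size_iota m d) -(count_predC f (iota m d)).
  rewrite -[X in X < _]addn0 ltn_add2l -has_count.
  by apply/hasP; exists j; rewrite // mem_iota.
have := leq_divM (q - d) d.
have : (q - d) %/ d <= q - d by exact: leq_div.
lia.
Qed.

(** As [p] is invertible modulo 5, five consecutive terms of the progression meet every class. *)
Lemma class_gap p r s a : prime p -> p != 5 ->
  exists2 j, a <= j < a + 5 & ~~ (r + p * j != s %[mod 5]).
Proof.
move=> pr_p p_neq5.
have p5 : p %% 5 != 0.
  by apply: contra p_neq5; rewrite -/(5 %| p) dvdn_prime2 // eq_sym.
have solve u v w : u < 5 -> v < 5 -> w < 5 -> u != 0 ->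
    exists2 j, j < 5 & (v + u * j) %% 5 == w.
  case: u => [|[|[|[|[|//]]]]] //; case: v => [|[|[|[|[|//]]]]] //;
  case: w => [|[|[|[|[|//]]]]] // _ _ _ _;
  by [exists 0 | exists 1 | exists 2 | exists 3 | exists 4].
have lt5 m : m %% 5 < 5 by apply: ltn_pmod.
have [j lt_j5 eq_j] := solve (p %% 5) ((r + p * a) %% 5) (s %% 5)
  (lt5 _) (lt5 _) (lt5 _) p5.
have {}eq_j : r + p * (a + j) == s %[mod 5].
  by rewrite mulnDr addnA -modnDm -(modnMml p j) modnDmr.
by exists (a + j); [lia | rewrite negbK].
Qed.

Lemma milestone_checkP t m s n : milestone_check t m s ->
  N.to_nat m < n <= N.to_nat (last m s) ->
  exists2 b, b \in s & n <= N.to_nat b /\ N.to_nat (cover_bound t b) < n.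
Proof.
elim: s m => [|b s IHs] m /=; first by move=> _; lia.
move=> /andP[/N.leb_spec0 le_b /IHs IH] lt_n.
case: (leqP n (N.to_nat b)) => [le_nb|lt_bn].
  by exists b; [rewrite mem_head | split=> //; lia].
have [|c sc bound_c] := IH; first by lia.
by exists c; rewrite // inE sc orbT.
Qed.

Lemma size_strike q c l : size (strike q c l) = size l.
Proof. by elim: l c => [|b l IHl] [|c] //=; rewrite IHl. Qed.

Lemma size_sieve s n : size (sieve s n) = n.
Proof.
rewrite /sieve; elim: s => [|qc s IHs] /=; first exact: size_nseq.
by rewrite size_strike.
Qed.

Lemma weight_sumE f a l :
  weight_sum f a l = \sum_(j <- iota 0 (size l) | nth false l j) f (4 * j + a).
Proof.
elim: l a => [|b l IHl] a /=; first by rewrite big_nil.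
rewrite big_cons /= IHl -[1]/(1 + 0) iotaDl big_map /= muln0 add0n.
have -> : \sum_(j <- iota 0 (size l) | nth false l j) f (4 * j + (a + 4)) =
          \sum_(j <- iota 0 (size l) | nth false l j) f (4 * (1 + j) + a).
  by apply: eq_bigr => j _; congr f; lia.
by case: b; rewrite ?mul1n.
Qed.

(** Union bound: the class modulo 5 is counted in full, every other class only outside of it. The
    estimates use the milestone [m >= n] in place of [n]. *)
Lemma cover_bound_ge n (r : nat -> nat) (m : N) (C : seq bool) t :
  0 < n <= N.to_nat m -> N.to_nat m <= 4 * size C + 9 ->
  (forall j, j < size C -> prime (4 * j + 9) -> nth false C j) ->
  block_check C t ->
  split_cover n r ->
  n <= N.to_nat (cover_bound t m).
Proof.
move=> /andP[n_gt0 le_nm] m_le C_prime C_check cover.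
pose w p :=
  count (fun i => (i == r p %[mod p]) && (i != r 5 %[mod 5])) (iota 0 n).
pose ok p := split_prime p && (p < N.to_nat m).
(* Being 0 off the split primes, [f] ignores composite numbers that survive. *)
pose f p := if ok p && (p != 5) then w p else 0.
have f_out p : N.to_nat m <= p -> f p = 0.
  by move=> le_np; rewrite /f /ok ltnNge le_np andbF.
have f_le p q : N.to_nat m <= p * q -> f p <= q - q %/ 5.
  rewrite /f /ok; case: ifP => // /andP[/andP[/andP[pr_p _] _] p_neq5] le_m.
  have := @count_class_le p (r p) n q (fun i => i != r 5 %[mod 5])
            (prime_gt0 pr_p) (leq_trans le_nm le_m).
  move/leq_trans; apply.
  apply: (@count_sparse 0 5) => // a.
  exact: class_gap.
have := weight_sum_cost (isT : 0 < 9) f_out f_le C_check.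
rewrite N2Nat.id weight_sumE.
have w_le : count (fun i => i != r 5 %[mod 5]) (iota 0 n) <=
    \sum_(j <- iota 0 (size C) | nth false C j) f (4 * j + 9).
  rewrite -big_filter -(big_map (fun j => 4 * j + 9) xpredT f).
  set X := map _ _.
  have -> : \sum_(p <- X) f p =
            \sum_(p <- filter (fun p => ok p && (p != 5)) X) w p.
    by rewrite [RHS]big_filter [RHS]big_mkcond; apply: eq_bigr.
  apply: count_union => i; rewrite mem_iota add0n => /= lt_in ni5.
  have [p [split_p lt_pn i_p]] := cover i lt_in.
  have p5 : p != 5 by apply: contraNneq ni5 => p5; rewrite p5 in i_p.
  apply/hasP; exists p; last by rewrite i_p ni5.
  rewrite mem_filter /ok split_p p5 (leq_trans lt_pn) //=.
  move: split_p => /andP[pr_p /eqP p_mod].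
  have p_gt1 := prime_gt1 pr_p.
  have pE : p = 4 * ((p - 9) %/ 4) + 9 by lia.
  have lt_j : (p - 9) %/ 4 < size C by lia.
  apply/mapP; exists ((p - 9) %/ 4) => //.
  rewrite mem_filter mem_iota add0n lt_j /= andbT; apply: C_prime => //.
  by rewrite -pE.
move=> /(leq_trans w_le) {w_le}.
rewrite /cover_bound; case: ifP => [/N.leb_spec0 m_le5|/N.leb_spec0 m_gt5 w_le].
  have [p [/andP[pr_p /eqP p_mod] lt_pn _]] := cover 0 n_gt0.
  have := prime_gt1 pr_p; lia.
have m5 : n <= 5 * N.to_nat ((m - 1) / 5 + 1).
  have := N.mod_lt (m - 1) 5 ltac:(lia); have := N.div_mod (m - 1) 5 ltac:(lia).
  by move: (N.modulo _ _) (N.div _ _) => v u; lia.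
have c5_le : count (fun i => i == r 5 %[mod 5]) (iota 0 n) <=
             N.to_nat ((m - 1) / 5 + 1).
  have := @count_class_le 5 (r 5) n _ xpredT isT m5.
  rewrite count_predT size_iota; apply: leq_trans.
  by apply: eq_leq; apply: eq_count => i; rewrite andbT.
rewrite N2Nat.inj_add -[leqLHS](size_iota 0 n).
by rewrite -(count_predC (fun i => i == r 5 %[mod 5])) leq_add.
Qed.

(* Deciding these equalities by conversion would compare unary numbers. *)
Lemma nat_64998 : 64998 = N.to_nat 64998.
Proof.
rewrite /Nat.of_num_uint /Nat.of_uint; cbn [Nat.of_uint_acc].
by rewrite !Stdlib.Arith.PeanoNat.Nat.tail_mul_spec; lia.
Qed.

Lemma nat_260000 : 260000 = N.to_nat 260000.
Proof.
rewrite /Nat.of_num_uint /Nat.of_uint; cbn [Nat.of_uint_acc].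
by rewrite !Stdlib.Arith.PeanoNat.Nat.tail_mul_spec; lia.
Qed.

Lemma no_single_class_cover_of_checks (K : nat) s t ms (M n : nat) r :
  all (fun qc => [&& 1 < qc.1, qc.1 < 4 * qc.2 + 9 &
                     qc.1 %| 4 * qc.2 + 9]) s ->
  block_check (sieve s K) t -> milestone_check t 0 ms ->
  M <= N.to_nat (last 0%num ms) ->
  {in ms, forall b, N.to_nat b <= 4 * K + 9} ->
  0 < n < M ->
  ~ split_cover n r.
Proof.
move=> s_valid s_check ms_check last_ge ms_le /andP[n_gt0 n_lt] cover.
have [|b b_in [le_nb]] := milestone_checkP ms_check (n := n).
  by rewrite n_gt0 (leq_trans (ltnW n_lt)).
rewrite ltnNge => /negP[].
apply: (cover_bound_ge (r := r)) s_check cover; rewrite ?size_sieve ?n_gt0 //.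
  exact: ms_le.
by move=> j; apply: nth_sieve.
Qed.

Lemma strides_valid :
  all (fun qc => [&& 1 < qc.1, qc.1 < 4 * qc.2 + 9 & qc.1 %| 4 * qc.2 + 9])
    strides.
Proof. by []. Qed.

Theorem no_single_class_cover n (r : nat -> nat) : 0 < n < 260000 ->
  ~ split_cover n r.
Proof.
have last_ge : 260000 <= N.to_nat (last 0%num milestones).
  rewrite nat_260000; exact: leqnn.
have ms_le : {in milestones, forall b, N.to_nat b <= 4 * 64998 + 9}.
  have /allP ms_le : all (fun b => (b <=? 260000)%num) milestones by [].
  by rewrite nat_64998 => b /ms_le/N.leb_spec0; lia.
exact (no_single_class_cover_of_checks strides_valid sieve_check
         milestones_check last_ge ms_le).
Qed.

(** * Counting primes that are 1 modulo 4 *)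

(** Put [t = trunc_log 2 n]. For large [n] the left side is less than [n ^ d], which is at most
    [2 ^ (d * (t + 1))], and [d * (t + 1) <= n] because [4 * d <= t] and
    [t * (t + 1) <= 2 * 2 ^ t]. *)
Lemma poly_lt_exp2 c k :
  exists N, forall n, N <= n -> c * (2 * n + 1) ^ k < 2 ^ n.
Proof.
have sqr_le t : t * (t + 1) <= 2 * 2 ^ t.
  elim: t => // t IHt; have := ltn_expl t (isT : 1 < 2).
  by rewrite expnS; nia.
pose d := 2 * k + 2; exists (c + 3 + 2 ^ (4 * d)) => n n_ge.
have n_gt1 : 1 < n by lia.
have [t_lo t_hi] := andP (trunc_log_bounds (isT : 1 < 2) (ltnW n_gt1)).
have : 4 * d <= trunc_log 2 n by rewrite trunc_log_max //; lia.
move: (trunc_log 2 n) t_lo t_hi => t t_lo t_hi t_ge.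
have le_n : d * t.+1 <= n.
  by have := sqr_le t; nia.
apply: (@leq_trans (n ^ d)); last first.
  apply: (@leq_trans ((2 ^ t.+1) ^ d)).
    by rewrite leq_exp2r ?(ltnW t_hi) // /d; lia.
  by rewrite -expnM leq_exp2l // mulnC.
apply: (@leq_ltn_trans (n * (n ^ 2) ^ k)).
  apply: leq_mul; first by lia.
  case: (posnP k) => [->|k_gt0]; first by rewrite !expn0.
  by rewrite leq_exp2r //; nia.
by rewrite -expnM -expnS ltn_exp2l // /d; lia.
Qed.

Definition smooth (B n : nat) := (0 < n) && all (fun p => p <= B) (primes n).

(** A smooth number is determined by its exponents at the primes up to [B], each of which is at most
    [e]. *)
Lemma count_smooth B e :
  count (smooth B) (iota 0 (2 ^ e).+1) <= e.+1 ^ B.+1.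
Proof.
rewrite -size_filter; set s := filter _ _.
pose phi n := [ffun p : 'I_B.+1 => inord (logn p n) : 'I_e.+1].
have <- : #|{ffun 'I_B.+1 -> 'I_e.+1}| = e.+1 ^ B.+1.
  by rewrite card_ffun !card_ord.
rewrite -(size_map phi).
suff /card_uniqP <- : uniq (map phi s) by exact: max_card.
rewrite map_inj_in_uniq ?filter_uniq ?iota_uniq // => m n.
rewrite !mem_filter !mem_iota !add0n !ltnS /smooth /=.
have log_le p k : 0 < k -> k <= 2 ^ e -> logn p k <= e.
  move=> k_gt0 k_le; rewrite -(@leq_exp2l 2) //; apply: leq_trans k_le.
  have [pr_p|/negPf npr_p] := boolP (prime p); last first.
    by rewrite lognE npr_p expn0.
  rewrite (leq_trans _ (dvdn_leq k_gt0 (pfactor_dvdnn p k))) //.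
  case: (posnP (logn p k)) => [->//|l_gt0].
  by rewrite leq_exp2r ?prime_gt1.
move=> /andP[/andP[m_gt0 /allP m_sm] m_le] /andP[/andP[n_gt0 /allP n_sm] n_le].
move=> /ffunP eq_phi; apply: eqn_from_log => // p.
have [le_pB|lt_Bp] := leqP p B.
  have := eq_phi (inord p); rewrite !ffunE inordK // => /(f_equal val) /=.
  by rewrite !inordK ?ltnS ?log_le.
have log0 k : {in primes k, forall p, p <= B} -> logn p k = 0.
  move=> k_sm; apply/eqP; rewrite -leqn0 leqNgt logn_gt0.
  by apply/negP => /k_sm; rewrite leqNgt lt_Bp.
by rewrite !log0.
Qed.

(** By Fermat, [(-1) ^ (p %/ 2) = k ^ (p - 1) = 1] modulo an odd [p], so [p %/ 2] is even. *)
Lemma dvdn_sqr1_mod4 p k : prime p -> p %| k ^ 2 + 1 -> p = 2 \/ split_prime p.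
Proof.
move=> pr_p; rewrite (dvdn_pcharf (pchar_Fp pr_p)) natrD natrX => /eqP sqr_k.
have [p2|p_odd] := even_prime pr_p; [by left|right].
rewrite /split_prime pr_p /=.
have k_nz : (k%:R != 0 :> 'F_p)%R.
  apply: contra_eq_neq sqr_k => ->; rewrite expr0n add0r oner_neq0 //.
have pE : (2 * (p %/ 2)).+1 = p by lia.
have : (k%:R ^+ (2 * (p %/ 2)).+1 = k%:R :> 'F_p)%R.
  by rewrite pE -[X in (_ ^+ X)%R](card_Fp pr_p) expf_card.
have sqr_kN : (k%:R ^+ 2 = -1 :> 'F_p)%R by apply/eqP; rewrite -addr_eq0 sqr_k.
rewrite exprS -[RHS]mulr1 => /(mulfI k_nz).
rewrite exprM sqr_kN -signr_odd.
case: (boolP (odd _)) => [_|p2_even _]; last by lia.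
move/eqP; rewrite expr1 eq_sym -subr_eq0 opprK -[(1 + 1)%R]/(2%:R)%R.
rewrite -(dvdn_pcharf (pchar_Fp pr_p)) => /dvdn_leq.
by have := prime_gt1 pr_p; lia.
Qed.

(** The polynomial [X ^ (p %/ 2) - 1] has too few roots to vanish at all nonzero residues. If [a] is
    not a root, then [a ^ (p %/ 2) = -1], with square root [a ^ (p %/ 4)]. *)
Lemma sqrt_m1_mod p : split_prime p -> exists i, p %| i ^ 2 + 1.
Proof.
move=> /andP[pr_p p_mod]; have p_gt1 := prime_gt1 pr_p.
have [a a_nz a_exp] : exists2 a : 'F_p, a != 0%R & (a ^+ (p %/ 2) != 1)%R.
  apply/exists_inP; apply: contraT => /exists_inPn all_roots.
  pose P := ('X^(p %/ 2) - 1 : {poly 'F_p})%R.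
  have P_size : size P = (p %/ 2).+1.
    by rewrite size_XnsubC //; lia.
  have P_nz : P != 0%R by rewrite -size_poly_gt0 P_size.
  have := max_poly_roots P_nz (rs := enum (predC1 (0%R : 'F_p))).
  rewrite enum_uniq -cardE cardC1 card_Fp // P_size.
  case: allP => [_ /(_ isT isT)|[]]; first by lia.
  move=> a; rewrite mem_enum => /all_roots; rewrite negbK => /eqP a_exp.
  by rewrite /root !hornerE a_exp subrr.
exists (val (a ^+ (p %/ 4))%R).
rewrite (dvdn_pcharf (pchar_Fp pr_p)) natrD natrX natr_Zp -exprM.
have -> : p %/ 4 * 2 = p %/ 2 by lia.
have : ((a ^+ (p %/ 2)) ^+ 2 == 1)%R.
  rewrite -exprM; apply/eqP; apply: (mulfI a_nz); rewrite -exprS mulr1.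
  have -> : (p %/ 2 * 2).+1 = #|'F_p| by rewrite card_Fp //; lia.
  exact: expf_card.
by rewrite sqrf_eq1 (negPf a_exp) /= -addr_eq0.
Qed.

Lemma count_sqrt_m1 p X : prime p -> p != 2 ->
  count (fun k => p %| k ^ 2 + 1) (iota 0 X) <= 2 * (X %/ p + 1).
Proof.
move=> pr_p p_neq2; have p_gt0 := prime_gt0 pr_p.
case: (boolP (has (fun k => p %| k ^ 2 + 1) (iota 0 X))) => [|no_root]; last first.
  by move: no_root; rewrite has_count -leqNgt leqn0 => /eqP ->.
move=> /hasP[a _ a_root].
have X_le : X <= p * (X %/ p + 1).
  by rewrite {1}(divn_eq X p) mulnDr mulnC leq_add2l muln1 ltnW ?ltn_pmod.
pose Q r k := k == r %[mod p].
pose r : 'F_p := a%:R%R.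
have sqr_r k : p %| k ^ 2 + 1 -> (k%:R ^+ 2 = -1 :> 'F_p)%R.
  rewrite (dvdn_pcharf (pchar_Fp pr_p)) natrD natrX => /eqP k_root.
  by apply/eqP; rewrite -addr_eq0 k_root.
apply: (@leq_trans (\sum_(m <- [:: val r; val (- r)%R])
                      count (Q m) (iota 0 X))).
  apply: count_union => k _ k_root; rewrite /= orbF /Q.
  have Q_val (u : 'F_p) : (k%:R == u)%R -> k == val u %[mod p].
    by rewrite -val_eqE /= val_Fp_nat // => /eqP <-; rewrite modn_mod.
  have : (k%:R ^+ 2 == r ^+ 2)%R by rewrite !sqr_r.
  by rewrite eqf_sqr => /orP[/Q_val->|/Q_val->]; rewrite ?orbT.
rewrite big_cons big_cons big_nil addn0 mul2n -addnn.
have class_le m : count (Q m) (iota 0 X) <= X %/ p + 1.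
  have := @count_class_le p m X _ xpredT p_gt0 X_le.
  rewrite count_predT size_iota; apply: leq_trans.
  by apply: eq_leq; apply: eq_count => i; rewrite andbT.
by rewrite leq_add ?class_le.
Qed.

Lemma count_iotaE P n : count P (iota 0 n) = \sum_(0 <= i < n | P i) 1.
Proof. by rewrite -sum1_count /index_iota subn0. Qed.

(** Between [4 ^ j] and [4 ^ j.+1] there are fewer than [2 ^ j.+1 / 16] split primes, each
    contributing at most [2 ^ n %/ 4 ^ j]. Times 16, that is at most [2 ^ (n + 1 - j)], the amount
    by which the second term drops. *)
Lemma sum_split_quotients J n j :
  (forall i, J <= i -> 16 * count split_prime (iota 0 (4 ^ i).+1) < 2 ^ i) ->
  J <= j <= n ->
  16 * (\sum_((4 ^ J).+1 <= p < (4 ^ j).+1 | split_prime p) 2 ^ n %/ p) +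
    2 ^ (n + 2 - j) <= 2 ^ (n + 2 - J).
Proof.
move=> few /andP[]; elim: j => [|j IHj].
  by rewrite leqn0 => /eqP ->; rewrite big_geq.
rewrite leq_eqVlt => /predU1P[->|]; first by rewrite big_geq.
rewrite ltnS => le_Jj lt_jn; have {}IHj := IHj le_Jj (ltnW lt_jn).
rewrite (big_cat_nat _ _ (n := (4 ^ j).+1)) /=; last 2 first.
- by rewrite ltnS leq_exp2l.
- by rewrite ltnS leq_exp2l.
set S := \sum_(_ <= p < _ | _) _ in IHj *.
have block : 16 * (\sum_((4 ^ j).+1 <= p < (4 ^ j.+1).+1 | split_prime p)
                     2 ^ n %/ p) <= 2 ^ (n + 1 - j).
  apply: (@leq_trans (16 * (count split_prime (iota 0 (4 ^ j.+1).+1) *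
                            (2 ^ n %/ 4 ^ j)))).
    rewrite leq_mul2l count_iotaE big_distrl /=.
    rewrite [leqRHS](big_cat_nat _ _ (n := (4 ^ j).+1)) //=; last first.
      by rewrite ltnS leq_exp2l.
    apply: leq_trans (leq_addl _ _).
    rewrite big_nat_cond [leqRHS]big_nat_cond.
    apply: leq_sum => p /andP[/andP[lt_p _] _].
    by rewrite mul1n leq_div2l ?expn_gt0 // ltnW.
  rewrite mulnA; apply: (@leq_trans (2 ^ j.+1 * (2 ^ n %/ 4 ^ j))).
    by rewrite leq_mul2r (ltnW (few _ (leqW le_Jj))) orbT.
  rewrite -[4]/(2 ^ 2) -expnM.
  case: (leqP (2 * j) n) => [le_2j|lt_2j]; last first.
    by rewrite divn_small ?muln0 // ltn_exp2l.
  rewrite -expnB // -expnD leq_exp2l //; lia.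
have powE : 2 ^ (n + 2 - j) = 2 * 2 ^ (n + 1 - j).
  by rewrite -expnS; congr (2 ^ _); lia.
have -> : n + 2 - j.+1 = n + 1 - j by lia.
by rewrite powE in IHj; lia.
Qed.

(** Suppose split primes are scarce from [J] on. For [k < X = 2 ^ n], either [k ^ 2 + 1] is smooth
    for [4 ^ J], which is rare by [count_smooth], or it has a split prime factor above [4 ^ J],
    which by [sum_split_quotients] happens for fewer than half of the [k]. *)
Lemma many_split_primes J :
  exists2 j, J <= j & 2 ^ j <= 16 * count split_prime (iota 0 (4 ^ j).+1).
Proof.
wlog J_ge2 : J / 2 <= J.
  move=> wlog_J; have [j j_ge j_many] := wlog_J (J + 2) ltac:(lia).
  by exists j => //; lia.
apply: contrapT => none.
have few i : J <= i -> 16 * count split_prime (iota 0 (4 ^ i).+1) < 2 ^ i.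
  by move=> le_Ji; rewrite ltnNge; apply/negP => many; apply: none; exists i.
have [N N_lt] := poly_lt_exp2 2 (4 ^ J).+1.
pose n := N + J; pose X := 2 ^ n.
have X2 : X ^ 2 = 2 ^ (2 * n) by rewrite mulnC expnM.
have X4 : X ^ 2 = 4 ^ n by rewrite X2 expnM.
have X_gt0 : 0 < X by rewrite expn_gt0.
have sqr_le k : k < X -> k ^ 2 + 1 <= X ^ 2 by nia.
pose B := 4 ^ J.
have smooth_le : count (fun k => smooth B (k ^ 2 + 1)) (iota 0 X) <=
                 (2 * n).+1 ^ B.+1.
  apply: leq_trans (count_smooth B (2 * n)).
  rewrite -!size_filter -[leqLHS](size_map (fun k => k ^ 2 + 1)).
  apply: uniq_leq_size.
    rewrite map_inj_uniq ?filter_uniq ?iota_uniq // => k l /addIn/eqP.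
    by rewrite eqn_exp2r // => /eqP.
  move=> _ /mapP[k + ->].
  rewrite !mem_filter !mem_iota !add0n => /andP[k_smooth k_lt].
  by rewrite k_smooth /= ltnS -X2 sqr_le.
have rough_le : count (fun k => ~~ smooth B (k ^ 2 + 1)) (iota 0 X) <=
    \sum_(B.+1 <= p < (4 ^ n).+1 | split_prime p) 2 * (X %/ p + 1).
  apply: (@leq_trans (\sum_(B.+1 <= p < (4 ^ n).+1 | split_prime p)
                        count (fun k => p %| k ^ 2 + 1) (iota 0 X))).
    rewrite -big_filter; apply: count_union => k.
    rewrite mem_iota add0n => /= k_lt; rewrite /smooth addn1 /= => /allPn[p].
    rewrite mem_primes /= -ltnNge => /andP[pr_p p_dv] lt_Bp.
    apply/hasP; exists p => //; rewrite mem_filter mem_index_iota lt_Bp /=.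
    have p_le : p <= k ^ 2 + 1 by rewrite dvdn_leq ?addn1.
    rewrite ltnS -X4 (leq_trans p_le) ?sqr_le // andbT.
    have [p2|//] := dvdn_sqr1_mod4 pr_p (k := k) ltac:(by rewrite addn1).
    have : 4 ^ 2 <= B by rewrite leq_exp2l.
    by move: lt_Bp; rewrite p2; lia.
  apply: leq_sum => p /andP[pr_p /eqP p_mod]; apply: count_sqrt_m1 => //.
  by apply: contra_eq_neq p_mod => ->.
have split_le : \sum_(B.+1 <= p < (4 ^ n).+1 | split_prime p) 1 <=
                count split_prime (iota 0 (4 ^ n).+1).
  rewrite count_iotaE [leqRHS](big_cat_nat _ _ (n := B.+1)) //=.
    exact: leq_addl.
  by rewrite ltnS leq_exp2l // leq_addl.
have le_Jn : J <= n by apply: leq_addl.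
have := @sum_split_quotients J n n few; rewrite le_Jn leqnn -/X -/B => /(_ isT).
have : count (fun k => smooth B (k ^ 2 + 1)) (iota 0 X) +
       count (fun k => ~~ smooth B (k ^ 2 + 1)) (iota 0 X) = X.
  exact: etrans (count_predC _ _) (size_iota _ _).
rewrite -big_distrr big_split /= in rough_le.
have := few n (leq_addl _ _); have := N_lt n (leq_addr _ _).
rewrite addn1 -/X -/B.
have : 4 * 2 ^ (n + 2 - J) <= 4 * X.
  by rewrite leq_mul2l leq_exp2l //; lia.
move: rough_le smooth_le split_le; move: (\sum_(_ <= _ < _ | _) _) => S1.
lia.
Qed.

(** * Choice of the line *)

Local Open Scope classical_set_scope.
Local Open Scope ring_scope.
Local Open Scope complex_scope.

Lemma crt_primes (r : nat -> nat) Z lo :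
  exists2 x, (lo <= x)%N & forall p, prime p -> (p <= Z)%N -> x = r p %[mod p].
Proof.
have [x x_r] : exists x, forall p, prime p -> (p <= Z)%N -> x = r p %[mod p].
  elim: Z => [|Z [x x_r]].
    by exists 0%N => p /prime_gt0; case: p.
  have [pr_Z|npr_Z] := boolP (prime Z.+1); last first.
    exists x => p pr_p; rewrite leq_eqVlt => /predU1P[pZ|]; last exact: x_r.
    by rewrite -pZ pr_p in npr_Z.
  have co_Z : coprime Z.+1 (Z`!)%N.
    rewrite prime_coprime //.
    have fact_Z n : (n <= Z)%N -> ~~ (Z.+1 %| n`!)%N; last exact: fact_Z.
    elim: n => [|n IHn] lt_nZ.
      by rewrite fact0 dvdn1 neq_ltn prime_gt1 ?orbT.
    by rewrite factS Euclid_dvdM // negb_or (IHn (ltnW lt_nZ)) gtnNdvd.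
  exists (chinese Z.+1 (Z`!)%N (r Z.+1) x) => p pr_p.
  rewrite leq_eqVlt => /predU1P[->|le_pZ]; first exact: chinese_modl.
  rewrite -(x_r p) // -(modn_dvdm _ (_ : (p %| Z`!)%N)) ?dvdn_fact ?prime_gt0 //.
  by rewrite chinese_modr // modn_dvdm // dvdn_fact ?prime_gt0.
exists (x + lo * Z`!)%N; first by have := fact_gt0 Z; nia.
move=> p pr_p le_pZ; rewrite -(x_r p) //; apply/eqP.
by rewrite -{2}[x]addn0 eqn_modDl mod0n -/(dvdn _ _) dvdn_mull // dvdn_fact ?prime_gt0.
Qed.

Definition point_norm (y x m : int) : int := (y + m * x) ^+ 2 + m ^+ 2.

Lemma point_normB_dvd y x m m' : (m - m' %| point_norm y x m - point_norm y x m')%Z.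
Proof.
apply/dvdzP; exists (2%:Z * y * x + (m + m') * (x ^+ 2 + 1)).
by rewrite /point_norm; ring.
Qed.

Lemma natr_Fp_eq p m n : prime p -> m = n %[mod p] -> m%:R = n%:R :> 'F_p.
Proof. by move=> pr_p eq_mn; apply: val_inj; rewrite /= !val_Fp_nat. Qed.

Lemma dvdz_Fp p (z : int) : prime p -> (p %| z)%Z = (z%:~R == 0 :> 'F_p).
Proof. by move=> pr_p; rewrite (dvdz_pcharf (pchar_Fp pr_p)). Qed.

Lemma split_prime_gt3 p : split_prime p -> (3 < p)%N.
Proof. by move=> /andP[/prime_gt1 p_gt1 /eqP p_mod]; lia. Qed.

(** Residues of [x], [y] and the center [c] at one prime. The one of [y] depends on the actual [x],
    because [x ^ 2 + 1] may have prime factors at which [x] is not prescribed; there [y = 1] keeps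
    [y] coprime to [x ^ 2 + 1]. *)
Lemma local_residues P (g : int) p : prime p -> (1 < P)%N ->
  exists rx ry rc : nat, forall x y c : nat,
    x = rx %[mod p] -> c = rc %[mod p] ->
    y = (if p %| x ^ 2 + 1 then 1 else ry)%N %[mod p] ->
    [/\ (p <= P)%N -> p = 2 \/ split_prime p -> (p %| x ^ 2 + 1)%N,
        (p <= P)%N -> ~~ (p %| y)%N,
        split_prime p \/ (P < p)%N -> (p %| point_norm y x c)%Z
      & split_prime p -> (P < p)%N -> (p %| point_norm y x (c%:Z + g))%Z].
Proof.
move=> pr_p P_gt1; have p_gt1 := prime_gt1 pr_p.
have normE (y x c : nat) (f : int) : (point_norm y x (c%:Z + f))%:~R =
    (y%:R + (c%:R + f%:~R) * x%:R) ^+ 2 + (c%:R + f%:~R) ^+ 2 :> 'F_p.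
  by rewrite !(rmorphD, rmorphM, rmorphXn) /= -!pmulrn.
have normE0 (y x c : nat) : (point_norm y x c)%:~R =
    (y%:R + c%:R * x%:R) ^+ 2 + c%:R ^+ 2 :> 'F_p.
  by rewrite -[c%:Z]addr0 normE addr0.
have sqr1E x : (p %| x ^ 2 + 1)%N = (x%:R ^+ 2 + 1 == 0 :> 'F_p).
  by rewrite (dvdn_pcharf (pchar_Fp pr_p)) natrD natrX.
have [le_pP|lt_Pp] := leqP p P.
  have [p_good|p_bad] := pselect (p = 2 \/ split_prime p); last first.
    exists 0%N, 1%N, 0%N => x y c _ _ y_r; split.
    + by [].
    + by move=> _; rewrite /dvdn y_r; case: ifP => _; rewrite modn_small.
    + by case=> // p_split; case: p_bad; right.
    + by [].
  have [i i_root] : exists i, (p %| i ^ 2 + 1)%N.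
    case: p_good => [->|/sqrt_m1_mod//]; by exists 1%N.
  (* For split [p], the choice [x = i], [y = 1], [c = i / 2] with [i ^ 2 = -1] makes the norm
     [1 + 2 * c * x + c ^ 2 * (x ^ 2 + 1)] vanish. *)
  exists i, 1%N, (val (i%:R / 2%:R : 'F_p)) => x y c x_i c_r y_r.
  have xi := natr_Fp_eq pr_p x_i.
  have x_root : (p %| x ^ 2 + 1)%N by rewrite sqr1E xi -sqr1E.
  rewrite x_root in y_r; split=> // [_|p_split].
    by rewrite /dvdn y_r modn_small.
  have {}p_split : split_prime p.
    by case: p_split.
  have two_nz : 2%:R != 0 :> 'F_p.
    by rewrite -(dvdn_pcharf (pchar_Fp pr_p)) gtnNdvd // ltnW // split_prime_gt3.
  have i2 : i%:R ^+ 2 = -1 :> 'F_p.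
    by apply/eqP; rewrite -addr_eq0 -sqr1E.
  rewrite dvdz_Fp // normE0 (natr_Fp_eq pr_p c_r) natr_Zp (natr_Fp_eq pr_p y_r) xi.
  have : i%:R / 2%:R + i%:R / 2%:R = i%:R :> 'F_p by field.
  move: (i%:R / 2%:R) => h hE; rewrite -{}hE in i2 *.
  have -> : (1%:R + h * (h + h)) ^+ 2 + h ^+ 2 =
            ((h + h) ^+ 2 + 1) * (1 + h ^+ 2).
    by ring.
  by rewrite i2 addNr mul0r.
(* Above [P], the choice [x = 0], [y = u h], [c = - h] makes the norm at index
   [m] congruent to [m^2 - h^2], which vanishes at [c] and at [c + 2 h]. *)
have [u [h [uh hg]]] : exists u h : 'F_p,
    (u * h) ^+ 2 = - h ^+ 2 /\ (split_prime p -> h + h = g%:~R).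
  have [p_split|p_nsplit] := boolP (split_prime p); last first.
    by exists 0, 0; rewrite !mulr0 expr0n oppr0.
  have [i i_root] := sqrt_m1_mod p_split.
  exists i%:R, (g%:~R / 2%:R); split=> [|_].
    have i2 : i%:R ^+ 2 = -1 :> 'F_p.
      by apply/eqP; rewrite -addr_eq0 -sqr1E.
    by rewrite exprMn i2 mulN1r.
  have two_nz : 2%:R != 0 :> 'F_p.
    by rewrite -(dvdn_pcharf (pchar_Fp pr_p)) gtnNdvd // (leq_ltn_trans _ lt_Pp).
  by field.
exists 0%N, (val (u * h)), (val (- h)) => x y c x_r c_r y_r.
have xE := natr_Fp_eq pr_p x_r; have cE := natr_Fp_eq pr_p c_r.
have yE : y%:R = u * h.
  move: y_r; rewrite sqr1E xE expr0n add0r oner_eq0 => /(natr_Fp_eq pr_p) ->.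
  by rewrite natr_Zp.
rewrite natr_Zp in cE; split=> //.
  by move=> _; rewrite dvdz_Fp // normE0 xE cE yE mulr0 addr0 uh sqrrN addNr.
move=> p_split _; rewrite dvdz_Fp // normE xE cE yE mulr0 addr0 uh -hg //.
by apply/eqP; ring.
Qed.

(** Smooth offsets of both signs are matched with distinct split primes above [P] and up to [M]. For
    [M = 4 ^ j] there are at most [2 * (2 * j + 1) ^ P.+1] of the former and at least
    [2 ^ j / 16 - P.+1] of the latter. *)
Lemma smooth_assignment P :
  exists (M : nat) (g : nat -> int), (5 <= M)%N /\
    forall f : int, (`|f| <= M)%N -> smooth P `|f| ->
      exists p, [/\ split_prime p, (P < p)%N, (p <= M)%N & g p = f].
Proof.
have [N N_lt] := poly_lt_exp2 (32 + 16 * P.+1) P.+1.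
have [j j_ge many] := many_split_primes (N + 2).
have {N_lt} few := N_lt j ltac:(lia).
pose M := (4 ^ j)%N; exists M.
pose sm := [seq n <- iota 0 M.+1 | smooth P n].
pose F := [seq n%:Z | n <- sm] ++ [seq - n%:Z | n <- sm].
pose s := [seq p <- iota 0 M.+1 | split_prime p && (P < p)%N].
(* Any [p] that is not matched with an offset gets the default 0. *)
exists (fun p => nth 0 F (index p s)); split.
  by apply: (@leq_trans (4 ^ 2)); rewrite // leq_exp2l //; lia.
have F_size : (size F <= size s)%N.
  have sm_size : (size sm <= (2 * j + 1) ^ P.+1)%N.
    rewrite size_filter addn1 /M -[4%N]/(2 ^ 2)%N -expnM.
    exact: count_smooth.
  have : (count split_prime (iota 0 M.+1) <= size s + P.+1)%N.
    rewrite size_filter -[X in (_ <= _ + X)%N](size_iota 0 P.+1).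
    rewrite -[X in (X <= _)%N]size_filter -[X in (_ <= X + _)%N]size_filter -size_cat.
    apply: uniq_leq_size; first by rewrite filter_uniq // iota_uniq.
    move=> p; rewrite mem_cat !mem_filter !mem_iota !add0n => /andP[-> ->] /=.
    by rewrite !ltnS; case: leqP.
  rewrite size_cat !size_map.
  have : (0 < (2 * j + 1) ^ P.+1)%N by rewrite expn_gt0 addn1.
  move: sm_size few many; rewrite -/M.
  move: (count _ _) (size sm) (size s) (expn (2 * j + 1) _) => a b d e.
  nia.
move=> f f_le f_smooth.
have fF : f \in F.
  have abs_sm : `|f|%N \in sm.
    by rewrite mem_filter f_smooth mem_iota add0n ltnS f_le.
  rewrite mem_cat; case: (lerP 0 f) => f_sgn; apply/orP; [left|right].
    by apply/mapP; exists `|f|%N => //; lia.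
  by apply/mapP; exists `|f|%N => //; lia.
have lt_i : (index f F < size s)%N by rewrite (leq_trans _ F_size) // index_mem.
have := mem_nth 0%N lt_i; rewrite mem_filter mem_iota add0n ltnS.
move=> /andP[/andP[p_split p_gt] p_le].
exists (nth 0%N s (index f F)); split=> //.
by rewrite index_uniq ?nth_index // filter_uniq // iota_uniq.
Qed.

(** The order of quantifiers matters: [y] can be arbitrarily large for fixed [x], which yields
    infinitely many lines, and [c] can be arbitrarily large for fixed [y], which places the window
    beyond [alpha0]. *)
Lemma line_parameters P : (1 < P)%N ->
  exists (x M : nat), [/\ odd x, (5 <= M)%N,
    forall p, split_prime p -> (p <= P)%N -> (p %| x ^ 2 + 1)%N &
  forall lo, exists y : nat, [/\ (lo <= y)%N, coprime y (x ^ 2 + 1),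
    forall p, prime p -> (p <= P)%N -> ~~ (p %| y)%N &
  forall lo', exists2 c : nat, (lo' <= c)%N &
    forall f : int, (`|f| <= M)%N ->
      exists p (f' : int), [/\ prime p, (`|f'| <= M)%N, f' != f,
        (p %| f' - f)%Z & (p %| point_norm y x (c%:Z + f))%Z]]].
Proof.
move=> P_gt1; have [M [g [M_ge5 assign]]] := smooth_assignment P.
have /choice[r r_local] : forall p, exists r : nat * nat * nat,
    prime p -> forall x y c : nat,
    x = r.1.1 %[mod p] -> c = r.2 %[mod p] ->
    y = (if p %| x ^ 2 + 1 then 1 else r.1.2)%N %[mod p] ->
    [/\ (p <= P)%N -> p = 2 \/ split_prime p -> (p %| x ^ 2 + 1)%N,
        (p <= P)%N -> ~~ (p %| y)%N,
        split_prime p \/ (P < p)%N -> (p %| point_norm y x c)%Z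
      & split_prime p -> (P < p)%N -> (p %| point_norm y x (c%:Z + g p))%Z].
  move=> p; have [pr_p|npr_p] := boolP (prime p); last first.
    by exists (0, 0, 0)%N.
  have [rx [ry [rc r_loc]]] := local_residues (g p) pr_p P_gt1.
  by exists (rx, ry, rc).
have [x _ x_r] := crt_primes (fun p => (r p).1.1) (P + M) 0.
have sqr1_le : forall p, (p %| x ^ 2 + 1)%N -> (p <= x ^ 2 + 1)%N.
  by move=> p /dvdn_leq; apply; rewrite addn1.
(* The bound [Z] covers all prime factors of [x ^ 2 + 1], so that [y] is 1 modulo each of them. *)
pose Z := (P + M + (x ^ 2 + 1))%N.
have PM_le : (P + M <= Z)%N by apply: leq_addr.
pose ry p := (if p %| x ^ 2 + 1 then 1 else (r p).1.2)%N.
(* Sample values [c0] and [y0] complete the hypotheses of [r_local] for claims that do not involve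
   them. *)
have [c0 _ c0_r] := crt_primes (fun p => (r p).2) (P + M) 0.
have [y0 _ y0_r] := crt_primes ry Z 0.
have x_dvd p :
    prime p -> (p <= P)%N -> p = 2 \/ split_prime p -> (p %| x ^ 2 + 1)%N.
  move=> pr_p p_le.
  have p_leM : (p <= P + M)%N by rewrite (leq_trans p_le) ?leq_addr.
  have p_leZ := leq_trans p_leM PM_le.
  by have [] := r_local p pr_p x y0 c0 (x_r p pr_p p_leM) (c0_r p pr_p p_leM)
                        (y0_r p pr_p p_leZ); auto.
exists x, M; split=> //.
- have := x_dvd 2 isT P_gt1 (or_introl (erefl _)).
  by rewrite dvdn2 oddD oddX /= addbT negbK.
- by move=> p p_split p_le; apply: x_dvd => //; [case/andP: p_split | right].
move=> lo; have [y y_ge y_r] := crt_primes ry Z lo.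
have y_1 p : prime p -> (p %| x ^ 2 + 1)%N -> ~~ (p %| y)%N.
  move=> pr_p p_dvd; rewrite /dvdn (y_r p pr_p) /ry ?p_dvd ?modn_small ?prime_gt1 //.
  by rewrite (leq_trans (sqr1_le p p_dvd)) // /Z; lia.
exists y; split=> //.
- apply: contraT => not_co; set d := gcdn y (x ^ 2 + 1).
  have d_gt1 : (1 < d)%N.
    by rewrite ltn_neqAle eq_sym not_co gcdn_gt0 addn1 orbT.
  have /negP[] := y_1 _ (pdiv_prime d_gt1) (dvdn_trans (pdiv_dvd d) (dvdn_gcdr _ _)).
  exact: dvdn_trans (pdiv_dvd d) (dvdn_gcdl _ _).
- move=> p pr_p p_le.
  have p_leM : (p <= P + M)%N by rewrite (leq_trans p_le) ?leq_addr.
  have p_leZ := leq_trans p_leM PM_le.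
  by have [] := r_local p pr_p x y c0 (x_r p pr_p p_leM) (c0_r p pr_p p_leM)
                        (y_r p pr_p p_leZ); auto.
move=> lo'; have [c c_ge c_r] := crt_primes (fun p => (r p).2) (P + M) lo'.
have r_at p (pr_p : prime p) (p_le : (p <= P + M)%N) :=
  r_local p pr_p x y c (x_r p pr_p p_le) (c_r p pr_p p_le)
          (y_r p pr_p (leq_trans p_le PM_le)).
exists c => // f f_le; have [f_smooth|f_rough] := boolP (smooth P `|f|).
  have [p [p_split lt_Pp p_le gp]] := assign f f_le f_smooth.
  have pr_p : prime p by case/andP: p_split.
  have [_ _ _] := r_at p pr_p (leq_trans p_le (leq_addl _ _)).
  rewrite gp => /(_ p_split lt_Pp) p_dvd.
  have f_nz : f != 0 by rewrite -absz_gt0; case/andP: f_smooth.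
  have p_gt0 := prime_gt0 pr_p.
  (* The partner lies [p <= M] away from [f] in the direction of 0, hence still in the window. *)
  case: (lerP 0 f) => f_sgn.
    exists p, (f - p%:Z); split=> //; try by lia.
    have -> : f - p%:Z - f = - p%:Z by ring.
    by rewrite dvdzE abszN.
  exists p, (f + p%:Z); split=> //; try by lia.
  have -> : f + p%:Z - f = p%:Z by ring.
  exact: dvdzz.
(* The center is paired with offset 5, as 5 is a split prime and [M >= 5]. *)
have [->|f_nz] := eqVneq f 0.
  exists 5%N, 5%:Z; split=> //.
  rewrite addr0; have [|_ _ + _] := r_at 5 isT; first by lia.
  by apply; left.
have [p pr_p [p_dvd lt_Pp]] : exists2 p, prime p & (p %| `|f|)%N /\ (P < p)%N.
  move: f_rough; rewrite /smooth absz_gt0 f_nz /= => /allPn[p].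
  by rewrite mem_primes -ltnNge => /and3P[pr_p _ p_dvd] lt_Pp; exists p.
have p_le : (p <= M)%N.
  by apply: leq_trans f_le; apply: dvdn_leq p_dvd; rewrite absz_gt0.
have [_ _ + _] := r_at p pr_p (leq_trans p_le (leq_addl _ _)).
move=> /(_ (or_intror lt_Pp)) p_norm.
exists p, 0; split=> //; first by rewrite eq_sym.
  by rewrite sub0r dvdzE abszN.
rewrite -(subrK (point_norm y x c) (point_norm _ _ _)) rpredD //.
apply: dvdz_trans (point_normB_dvd _ _ _ _).
by have -> : c%:Z + f - c%:Z = f by ring.
Qed.

(** * Gaussian integers on a line *)

Lemma shared_norm_dvd (y x a b m m' e f e' f' : int) :
  coprimez y (x ^+ 2 + 1) ->
  y + m * x = e * a - f * b -> m = e * b + f * a ->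
  y + m' * x = e' * a - f' * b -> m' = e' * b + f' * a ->
  (a ^+ 2 + b ^+ 2 %| (m - m') ^+ 2)%Z.
Proof.
move=> /coprimezP[[s t] /= bezout] re_m im_m re_m' im_m'.
(* With [z = y + m (x + i)] and [z' = y + m' (x + i)], both
   [(m - m') y = m z' - m' z] and [(m - m') (x^2 + 1) = (z - z') (x - i)] are
   multiples of [a + b i], hence so is [m - m' = (u + v i) (a + b i)]. *)
pose u := s * (m * e' - m' * e) + t * ((e - e') * x + (f - f')).
pose v := s * (m * f' - m' * f) + t * ((f - f') * x - (e - e')).
have u_re : u * a - v * b = m - m'.
  transitivity (s * (m * (e' * a - f' * b) - m' * (e * a - f * b)) +
    t * (((e * a - f * b) - (e' * a - f' * b)) * x +
         ((e * b + f * a) - (e' * b + f' * a)))).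
    by rewrite /u /v; ring.
  rewrite -re_m -re_m' -im_m -im_m'.
  transitivity ((s * y + t * (x ^+ 2 + 1)) * (m - m')); first by ring.
  by rewrite bezout mul1r.
have u_im : u * b + v * a = 0.
  transitivity (s * (m * (e' * b + f' * a) - m' * (e * b + f * a)) +
    t * (((e * b + f * a) - (e' * b + f' * a)) * x -
         ((e * a - f * b) - (e' * a - f' * b)))).
    by rewrite /u /v; ring.
  rewrite -re_m -re_m' -im_m -im_m'; ring.
apply/dvdzP; exists (u ^+ 2 + v ^+ 2).
have -> : (u ^+ 2 + v ^+ 2) * (a ^+ 2 + b ^+ 2) =
  (u * a - v * b) ^+ 2 + (u * b + v * a) ^+ 2 by ring.
by rewrite u_re u_im expr0n addr0.
Qed.

Lemma centered_quotient (w n : int) : 0 < n ->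
  exists q, (2 * (w - q * n) <= n) && (- n <= 2 * (w - q * n)).
Proof.
move=> n_gt0; exists ((2 * w + n) %/ (2 * n))%Z.
have := divz_eq (2 * w + n) (2 * n).
have := modz_ge0 (2 * w + n) (_ : 2 * n != 0).
have := ltz_pmod (2 * w + n) (_ : 0 < 2 * n).
move=> /(_ ltac:(lia)) lt_r /(_ ltac:(lia)) ge_r.
nia.
Qed.

Section Gaussian.
Variable R : realType.
Implicit Types (z w : R[i]).

Definition gint (a b : int) : R[i] := a%:~R +i* b%:~R.

Lemma gaussian_integerP z : gaussian_integer z <-> exists a b, z = gint a b.
Proof.
split=> [[/intrP[a Re_z] /intrP[b Im_z]]|[a [b ->]]].
  by exists a, b; case: z Re_z Im_z => u v /= -> ->.
by split; rewrite /= intr_int.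
Qed.

Lemma gaussian_gint a b : gaussian_integer (gint a b).
Proof. by apply/gaussian_integerP; exists a, b. Qed.

Lemma intr_gint a : a%:~R = gint a 0 :> R[i].
Proof. by rewrite -(rmorph_int (real_complex R)). Qed.

Lemma gintM a b c d :
  gint a b * gint c d = gint (a * c - b * d) (a * d + b * c).
Proof. by rewrite /gint !(rmorphB, rmorphD, rmorphM). Qed.

Lemma gintD a b c d : gint a b + gint c d = gint (a + c) (b + d).
Proof. by rewrite /gint !rmorphD. Qed.

Lemma gintN a b : - gint a b = gint (- a) (- b).
Proof. by rewrite /gint !rmorphN. Qed.

Lemma gint_inj a b c d : gint a b = gint c d -> a = c /\ b = d.
Proof. by case=> /intr_inj -> /intr_inj ->. Qed.

Lemma gint1 : gint 1 0 = 1.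
Proof. by []. Qed.

Lemma gint0 : gint 0 0 = 0.
Proof. by []. Qed.

Lemma gaussianM z w :
  gaussian_integer z -> gaussian_integer w -> gaussian_integer (z * w).
Proof.
move=> /gaussian_integerP[a [b ->]] /gaussian_integerP[c [d ->]].
by rewrite gintM; exact: gaussian_gint.
Qed.

Lemma gaussianD z w :
  gaussian_integer z -> gaussian_integer w -> gaussian_integer (z + w).
Proof.
move=> /gaussian_integerP[a [b ->]] /gaussian_integerP[c [d ->]].
by rewrite gintD; exact: gaussian_gint.
Qed.

Lemma gaussianN z : gaussian_integer z -> gaussian_integer (- z).
Proof.
move=> /gaussian_integerP[a [b ->]].
by rewrite gintN; exact: gaussian_gint.
Qed.

Lemma gint_unit a b : a ^+ 2 + b ^+ 2 = 1 -> gaussian_unit (gint a b).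
Proof.
move=> norm1; split; first exact: gaussian_gint.
exists (gint a (- b)); first exact: gaussian_gint.
rewrite gintM -gint1; congr gint; last by ring.
by rewrite -norm1; ring.
Qed.

Definition point (y x m : int) : R[i] := gint (y + m * x) m.

(** The norm of a common divisor divides both norms and, by [shared_norm_dvd], also [(m - m') ^ 2].
    It is not 1 for a non-unit and not 0 for [m != m'], so it has a prime factor. *)
Lemma common_divisor_prime (y x m m' : int) :
  coprimez y (x ^+ 2 + 1) -> m != m' ->
  common_nonunit_divisor (point y x m) (point y x m') ->
  exists p, [/\ prime p, (p %| m - m')%Z, (p %| point_norm y x m)%Z
              & (p %| point_norm y x m')%Z].
Proof.
move=> co_yx neq_m [q [/gaussian_integerP[a [b ->]] q_nunit]].
move=> [_ /gaussian_integerP[e [f ->]]]; rewrite gintM => /gint_inj[re_m im_m].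
move=> [_ /gaussian_integerP[e' [f' ->]]]; rewrite gintM => /gint_inj[re_m' im_m'].
have dvd_m := shared_norm_dvd co_yx re_m im_m re_m' im_m'.
set n := a ^+ 2 + b ^+ 2 in dvd_m.
have n_neq0 : n != 0.
  by apply: contraNneq neq_m => n0; move: dvd_m; rewrite n0 dvd0z sqrf_eq0 subr_eq0.
have n_neq1 : n != 1 by apply/eqP => /gint_unit.
have n_gt1 : (1 < `|n|)%N.
  have : 0 <= n by rewrite addr_ge0 ?sqr_ge0.
  by move: n_neq0 n_neq1; lia.
pose p := pdiv `|n|; have pr_p : prime p := pdiv_prime n_gt1.
have p_n : (p %| n)%Z by rewrite dvdzE pdiv_dvd.
exists p; split=> //.
- have := dvdz_trans p_n dvd_m; rewrite !dvdzE abszX /=.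
  by rewrite Euclid_dvdX // andbT.
- apply: dvdz_trans p_n _; apply/dvdzP; exists (e ^+ 2 + f ^+ 2).
  by rewrite /point_norm re_m im_m /n; ring.
- apply: dvdz_trans p_n _; apply/dvdzP; exists (e' ^+ 2 + f' ^+ 2).
  by rewrite /point_norm re_m' im_m' /n; ring.
Qed.

Lemma consecutive_coprime (y x m : int) :
  coprimez y (x ^+ 2 + 1) -> gaussian_coprime (point y x m) (point y x (m + 1)).
Proof.
move=> co_yx /(common_divisor_prime co_yx) [|p [pr_p]]; first by lia.
move=> /dvdzP[k]; have -> : m - (m + 1) = - 1 by ring.
move=> /(congr1 absz); rewrite abszM abszN /= => /esym/eqP.
by rewrite muln_eq1 => /andP[_ /eqP p1]; rewrite p1 in pr_p.
Qed.

Definition ideal z w : set R[i] := [set v | exists s t,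
  [/\ gaussian_integer s, gaussian_integer t & v = s * z + t * w]].

Lemma ideal_sub_mul z w u v q : gaussian_integer q ->
  ideal z w u -> ideal z w v -> ideal z w (u - q * v).
Proof.
move=> q_int [s [t [s_int t_int ->]]] [s' [t' [s'_int t'_int ->]]].
exists (s - q * s'), (t - q * t'); split; last by ring.
  by apply: gaussianD => //; apply/gaussianN/gaussianM.
by apply: gaussianD => //; apply/gaussianN/gaussianM.
Qed.

(** An element of least positive norm in the ideal divides all the others: rounding the quotient
    leaves a remainder of at most half the norm. *)
Lemma gaussian_gcd z w : gaussian_integer z -> gaussian_integer w -> z != 0 ->
  exists g, [/\ gaussian_integer g, ideal z w g,
                gaussian_dvd g z & gaussian_dvd g w].
Proof.
move=> z_int w_int z_neq0.
have one_int : gaussian_integer (1 : R[i]) by exact: (gaussian_gint 1 0).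
have zero_int : gaussian_integer (0 : R[i]) by exact: (gaussian_gint 0 0).
have z_id : ideal z w z by exists 1, 0; split=> //; ring.
have w_id : ideal z w w by exists 0, 1; split=> //; ring.
pose P n := `[< exists a b,
  [/\ ideal z w (gint a b), (0 < n)%N & a ^+ 2 + b ^+ 2 = n%:Z] >].
have P_ex : exists n, P n.
  have [a [b z_eq]] := (gaussian_integerP z).1 z_int.
  exists (absz (a ^+ 2 + b ^+ 2)); apply/asboolP; exists a, b; rewrite -z_eq.
  have norm_ge0 : 0 <= a ^+ 2 + b ^+ 2 by rewrite addr_ge0 ?sqr_ge0.
  split=> //; last by rewrite gez0_abs.
  rewrite absz_gt0; apply: contra z_neq0; rewrite paddr_eq0 ?sqr_ge0 // !sqrf_eq0.
  by rewrite z_eq => /andP[/eqP-> /eqP->].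
case: (ex_minnP P_ex) => n /asboolP[a [b [g_id n_gt0 norm_g]]] n_min.
exists (gint a b).
suff g_dvd v : gaussian_integer v -> ideal z w v -> gaussian_dvd (gint a b) v.
  by split; [exact: gaussian_gint | | exact: g_dvd | exact: g_dvd].
move=> /gaussian_integerP[c [d ->]] v_id.
have n_pos : 0 < n%:Z by rewrite ltz_nat.
(* The quotient of [c + d i] by [a + b i] is [(c + d i) (a - b i) / n]; both coordinates are
   rounded. *)
have [q /andP[q_hi q_lo]] := centered_quotient (c * a + d * b) n_pos.
have [q' /andP[q'_hi q'_lo]] := centered_quotient (d * a - c * b) n_pos.
exists (gint q q'); first exact: gaussian_gint.
have := ideal_sub_mul (gaussian_gint q q') v_id g_id.
rewrite gintM gintN gintD; set r := c + _; set r' := d + _ => r_id.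
have r_norm : (r ^+ 2 + r' ^+ 2) * n%:Z =
    (c * a + d * b - q * n%:Z) ^+ 2 + (d * a - c * b - q' * n%:Z) ^+ 2.
  by rewrite -norm_g /r /r'; ring.
have r_ge0 : 0 <= r ^+ 2 + r' ^+ 2 by rewrite addr_ge0 ?sqr_ge0.
have r_lt : r ^+ 2 + r' ^+ 2 < n%:Z.
  move: r_norm q_hi q_lo q'_hi q'_lo.
  move: (c * a + d * b - q * n%:Z) (d * a - c * b - q' * n%:Z) => u u'.
  clear -n_gt0 r_ge0; move: (r ^+ 2 + r' ^+ 2) r_ge0 => k k_ge0; nia.
have r0 : r ^+ 2 + r' ^+ 2 = 0.
  apply/eqP; rewrite eq_le r_ge0 andbT leNgt; apply/negP => r_gt0.
  have := n_min (absz (r ^+ 2 + r' ^+ 2)); rewrite leqNgt.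
  have -> : (absz (r ^+ 2 + r' ^+ 2)%R < n)%N by move: r_lt r_ge0; lia.
  suff -> : P (absz (r ^+ 2 + r' ^+ 2)) by move=> /(_ isT).
  apply/asboolP; exists r, r'; split=> //; last by rewrite gez0_abs.
  by rewrite absz_gt0 gt_eqF.
have : gint c d - gint q q' * gint a b = 0.
  move/eqP: r0; rewrite paddr_eq0 ?sqr_ge0 // !sqrf_eq0 => /andP[/eqP r0 /eqP r'0].
  by rewrite gintM gintN gintD -/r -/r' r0 r'0.
by rewrite gintM; exact: subr0_eq.
Qed.

Lemma prime_common_divisor (y x m m' : int) (p : nat) :
  prime p -> (p %| m' - m)%Z -> (p %| point_norm y x m)%Z ->
  common_nonunit_divisor (point y x m) (point y x m').
Proof.
move=> pr_p /dvdzP[k m'E] /dvdzP[l normE].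
have p_neq0 : gint p 0 != 0.
  by apply/eqP; rewrite -gint0 => /gint_inj[p0 _]; have := prime_gt0 pr_p; lia.
have [g [g_int [s [t [s_int t_int gE]]] [c c_int g_p] [d d_int g_m]]] :=
  gaussian_gcd (gaussian_gint p 0) (gaussian_gint (y + m * x) m) p_neq0.
(* The gcd [g] of [p] and the point is the divisor: if it were a unit, the
   identity [g = s p + t z] times the conjugate of [z] would make [z] a
   multiple of [p], hence [p] a unit. *)
exists g; split=> //; last first.
- exists (d + gint k 0 * gint x 1 * c).
    by apply: gaussianD => //; do 2?apply: gaussianM => //; exact: gaussian_gint.
  have -> : point y x m' = point y x m + gint k 0 * gint x 1 * gint p 0.
    rewrite /point !gintM gintD; have -> : m' = m + k * p by rewrite -m'E; ring.
    by congr gint; ring.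
  by rewrite /point g_m g_p; ring.
- by exists d.
move=> [_ [h h_int hg]].
pose a' := gint (y + m * x) (- m).
have a'E : a' = gint p 0 * (h * (s * a' + t * gint l 0)).
  transitivity (a' * (h * g)); first by rewrite hg mulr1.
  have a'_norm : a' * gint (y + m * x) m = gint l 0 * gint p 0.
    rewrite !gintM; congr gint; last by ring.
    move: normE; rewrite /point_norm => normE.
    by transitivity (l * p); [rewrite -normE|]; ring.
  rewrite gE.
  transitivity (h * (s * gint p 0 * a' + t * (a' * gint (y + m * x) m))).
    by ring.
  by rewrite a'_norm; ring.
have : gaussian_integer (h * (s * a' + t * gint l 0)).
  apply: gaussianM => //; apply: gaussianD; apply: gaussianM => //;
  exact: gaussian_gint.
case/gaussian_integerP=> u [v uvE]; rewrite uvE gintM in a'E.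
have [re_m im_m] := gint_inj a'E.
have aE : gint (y + m * x) m = gint p 0 * gint u (- v).
  by rewrite gintM; congr gint; [rewrite re_m|rewrite -[m]opprK im_m]; ring.
have : gaussian_integer (h * (s + t * gint u (- v))).
  apply: gaussianM => //; apply: gaussianD => //; apply: gaussianM => //.
  exact: gaussian_gint.
case/gaussian_integerP=> e [f efE].
have : gint p 0 * gint e f = gint 1 0.
  rewrite -efE gint1 -hg gE aE; ring.
rewrite gintM => /gint_inj[pe _].
move: pe; rewrite mul0r subr0 => /(congr1 absz)/eqP; rewrite abszM muln_eq1.
by move=> /andP[/eqP p1 _]; rewrite /= in p1; rewrite p1 in pr_p.
Qed.

Definition line (y x : int) : set R[i] :=
  [set z | complex.Re z = y%:~R + x%:~R * complex.Im z].

Lemma line_pointsP y x z :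
  gaussian_points (line y x) z <-> exists m, z = point y x m.
Proof.
split=> [[zL /gaussian_integerP[a [b zE]]]|[m ->]].
  exists b; move: zL; rewrite /line zE /= -rmorphM -rmorphD => /intr_inj aE.
  by rewrite /point aE mulrC.
split; last exact: gaussian_gint.
by rewrite /line /point /= rmorphD rmorphM mulrC.
Qed.

Lemma point_inj y x : injective (point y x).
Proof. by move=> m n /gint_inj[]. Qed.

Lemma primitive_line y x :
  coprimez y (x ^+ 2 + 1) -> primitive_gaussian_line (line y x).
Proof.
move=> co_yx; have p_on m : gaussian_points (line y x) (point y x m).
  by apply/line_pointsP; exists m.
have neq : point y x 0 != point y x 1 by apply/eqP => /point_inj.
split; last first.
  exists (point y x 0), (point y x (0 + 1)); split=> //; exact: consecutive_coprime.
split; last by exists (point y x 0), (point y x 1).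
exists (gint y 0), (gint x 1); split.
  by apply/eqP; rewrite -gint0 => /gint_inj[].
apply/seteqP; split=> z.
  move=> zL; exists (complex.Im z) => //; case: z zL => a b; rewrite /line /= => ->.
  apply/eqP; rewrite eq_complex /=.
  by rewrite !(mul0r, mulr0, mulr1, add0r, addr0, subr0) mulrC !eqxx.
move=> [t _ <-]; rewrite /line /= !(mul0r, mulr0, mulr1, add0r, addr0, subr0).
by rewrite mulrC.
Qed.

Lemma gaussian_norm_point y x m :
  gaussian_norm (point y x m) = (point_norm y x m)%:~R.
Proof. by rewrite /gaussian_norm /point_norm /= !(rmorphD, rmorphXn). Qed.

Lemma alpha0_line y x : exists c : int, alpha0 (line y x) = point y x c.
Proof.
pose better m n := (point_norm y x m < point_norm y x n) ||
  (point_norm y x m == point_norm y x n) && (n * x <= m * x).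
suff [m m_best] : exists m, forall n, better m n.
  have : exists z, [set a | gaussian_points (line y x) a /\
      forall b, gaussian_points (line y x) b ->
      gaussian_norm a < gaussian_norm b \/
      gaussian_norm a = gaussian_norm b /\ complex.Re b <= complex.Re a] z.
    exists (point y x m); split; first by apply/line_pointsP; exists m.
    move=> b /line_pointsP[n ->]; rewrite !gaussian_norm_point ltr_int.
    have := m_best n; rewrite /better => /orP[->|/andP[/eqP-> le_mn]]; [by left|right].
    by rewrite /= ler_int lerD2l.
  case=> z /(xgetI 0) [/line_pointsP[c c_eq] _].
  by exists c; rewrite /alpha0 c_eq.
pose P n := `[< exists m, point_norm y x m = n%:Z >].
have norm_ge0 m : 0 <= point_norm y x m by rewrite addr_ge0 ?sqr_ge0.
have P_ex : exists n, P n.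
  by exists `|point_norm y x 0|%N; apply/asboolP; exists 0; rewrite gez0_abs.
case: (ex_minnP P_ex) => n /asboolP[m m_norm] n_min.
have m_min k : n%:Z <= point_norm y x k.
  have : P `|point_norm y x k|%N by apply/asboolP; exists k; rewrite gez0_abs.
  by move/n_min; have := norm_ge0 k; lia.
have best_of k : point_norm y x k = n%:Z ->
    (forall l, point_norm y x l = n%:Z -> l * x <= k * x) -> forall l, better k l.
  move=> k_norm k_right l; rewrite /better k_norm.
  have := m_min l; rewrite le_eqVlt eq_sym => /orP[/eqP l_norm|->//].
  by rewrite l_norm eqxx k_right // orbT.
(* As a quadratic function of the index, the norm is minimal at no more than
   two points. *)
have [[k [k_norm k_right]]|none] :=
  pselect (exists k, point_norm y x k = n%:Z /\ m * x < k * x); last first.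
  exists m; apply: best_of => // l l_norm; rewrite leNgt; apply/negP => lt_ml.
  by apply: none; exists l.
exists k; apply: best_of => // l l_norm; rewrite leNgt; apply/negP => lt_kl.
have neq_mk : k - m != 0 by apply: contraTneq k_right => /subr0_eq ->; rewrite ltxx.
have neq_ml : l - m != 0.
  by apply: contraTneq (lt_trans k_right lt_kl) => /subr0_eq ->; rewrite ltxx.
have slope j : point_norm y x j = n%:Z -> j - m != 0 ->
    2%:Z * y * x + (j + m) * (x ^+ 2 + 1) = 0.
  move=> j_norm neq; apply: (mulfI neq); rewrite mulr0.
  transitivity (point_norm y x j - point_norm y x m); first by rewrite /point_norm; ring.
  by rewrite j_norm m_norm subrr.
have : (l - k) * (x ^+ 2 + 1) = 0.
  by have := slope k k_norm neq_mk; have := slope l l_norm neq_ml; lia.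
move/eqP; rewrite mulf_eq0 => /orP[/eqP/subr0_eq lk|/eqP x0].
  by rewrite lk ltxx in lt_kl.
by have := sqr_ge0 x; lia.
Qed.

(** For [x > 0] the real part grows with the index, so [alpha1] is the next point and [delta] is
    [x + i]. The shift [c] is the index of [alpha0]. *)
Lemma alpha_line y x : 0 < x ->
  exists c : int, forall k : nat, alpha (line y x) k = point y x (c + k%:Z).
Proof.
move=> x_gt0; have [c c_eq] := alpha0_line y x.
have right_iff z : right_gaussian_points (line y x) z <->
    exists2 m, c < m & z = point y x m.
  rewrite /right_gaussian_points /= c_eq; split.
    move=> [/line_pointsP[m ->]] /=; rewrite ltr_int ltrD2l ltr_pM2r // => lt_cm.
    by exists m.
  move=> [m lt_cm ->]; split; first by apply/line_pointsP; exists m.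
  by rewrite /= ltr_int ltrD2l ltr_pM2r.
have pointB m : point y x m - point y x c = (m - c)%:~R * gint x 1.
  rewrite /point gintN gintD.
  rewrite intr_gint.
  by rewrite gintM; congr gint; ring.
have d_neq0 : gint x 1 != 0 by apply/eqP; rewrite -gint0 => /gint_inj[].
have dist m : `|point y x m - point y x c| = `|m - c|%:~R * `|gint x 1|.
  by rewrite pointB normrM intr_norm.
exists c.
have a1_eq : alpha1 (line y x) = point y x (c + 1).
  have : exists z, [set a | right_gaussian_points (line y x) a /\
      forall b, right_gaussian_points (line y x) b ->
      `|a - alpha0 (line y x)| <= `|b - alpha0 (line y x)|] z.
    exists (point y x (c + 1)); split.
      by apply/right_iff; exists (c + 1) => //; lia.
    move=> _ /right_iff[m lt_cm ->]; rewrite c_eq !dist.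
    by rewrite ler_pM2r ?normr_gt0 // ler_int; lia.
  case=> z /(xgetI 0) [/right_iff[m lt_cm m_eq] m_near].
  rewrite /alpha1 m_eq; congr (point y x _).
  have := m_near (point y x (c + 1)); rewrite m_eq c_eq !dist.
  rewrite ler_pM2r ?normr_gt0 // ler_int => m_le.
  have : right_gaussian_points (line y x) (point y x (c + 1)).
    by apply/right_iff; exists (c + 1) => //; lia.
  by move/m_le; lia.
have not_vertical : ~ vertical (line y x).
  move=> vert; have := vert (point y x 0) (point y x 1).
  have on m : line y x (point y x m).
    by case: (line_pointsP y x (point y x m)) => _ [] //; exists m.
  by move=> /(_ (on 0) (on 1)) /= /intr_inj; lia.
move=> k; rewrite /alpha /delta.
case: asboolP => // _; rewrite a1_eq c_eq.
rewrite pmulrn intr_gint /point gintN !gintD gintM gintD.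
by congr gint; ring.
Qed.

End Gaussian.

(** * Prime divisors of the norms along a line *)

Lemma point_norm_Fp p (y x : nat) (m : int) : (point_norm y x m)%:~R =
  (y%:R + m%:~R * x%:R) ^+ 2 + m%:~R ^+ 2 :> 'F_p.
Proof. by rewrite !(rmorphD, rmorphM, rmorphXn) /= -!pmulrn. Qed.

(** As [p] does not divide [y], the index [m] is invertible modulo [p] and [(y + m x) / m] is a
    square root of -1. For [x] and [y] odd, the norm is odd. *)
Lemma norm_divisor_split p (y x : nat) (m : int) :
  prime p -> odd x -> odd y -> ~~ (p %| y)%N -> (p %| point_norm y x m)%Z ->
  split_prime p.
Proof.
move=> pr_p odd_x odd_y p_y; rewrite dvdz_Fp // => norm0.
have m_neq0 : m%:~R != 0 :> 'F_p.
  apply: contra p_y => /eqP m0; move: norm0.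
  rewrite point_norm_Fp m0 mul0r addr0 expr0n addr0 sqrf_eq0.
  by rewrite -(dvdn_pcharf (pchar_Fp pr_p)).
pose k : 'F_p := (y%:R + m%:~R * x%:R) / m%:~R.
have k_root : (p %| (val k) ^ 2 + 1)%N.
  rewrite (dvdn_pcharf (pchar_Fp pr_p)) natrD natrX natr_Zp /k exprMn exprVn.
  apply: contraTT norm0 => nz; apply: contra nz => /eqP norm0; apply/eqP.
  apply: (mulIf (expf_neq0 2 m_neq0)).
  by rewrite mulrDl mulfVK ?expf_neq0 // mul1r mul0r -norm0 point_norm_Fp.
have [p2|//] := dvdn_sqr1_mod4 pr_p k_root.
have odd1 n : odd n -> n%:R = 1 :> 'F_p.
  move=> odd_n; apply: (@natr_Fp_eq p n 1) => //.
  by rewrite p2 modn2 odd_n.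
have two0 : 2%:R = 0 :> 'F_p.
  by apply/eqP; rewrite -(dvdn_pcharf (pchar_Fp pr_p)) p2.
move: norm0; rewrite point_norm_Fp !odd1 //.
have -> : (1 + m%:~R * 1) ^+ 2 + m%:~R ^+ 2 =
  1 + 2%:R * (m%:~R + m%:~R ^+ 2) :> 'F_p by ring.
by rewrite two0 mul0r addr0 oner_eq0.
Qed.

(** Modulo a divisor of [x ^ 2 + 1] the norm is [y * (y + 2 * m * x)], which leaves a linear
    condition on [m]. *)
Lemma norm_divisor_class p (y x : nat) (m m' : int) :
  split_prime p -> (p %| x ^ 2 + 1)%N -> ~~ (p %| y)%N ->
  (p %| point_norm y x m)%Z -> (p %| point_norm y x m')%Z -> (p %| m - m')%Z.
Proof.
move=> p_split; have pr_p : prime p by case/andP: p_split.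
rewrite !(dvdn_pcharf (pchar_Fp pr_p)) !dvdz_Fp // !point_norm_Fp natrD natrX.
rewrite rmorphB /=; move=> x_root y_neq0.
have normE (u : 'F_p) : (y%:R + u * x%:R) ^+ 2 + u ^+ 2 =
    y%:R * (y%:R + 2%:R * u * x%:R) + u ^+ 2 * (x%:R ^+ 2 + 1) by ring.
have norm0 u : (y%:R + u * x%:R) ^+ 2 + u ^+ 2 == 0 :> 'F_p ->
    y%:R + 2%:R * u * x%:R = 0 :> 'F_p.
  by rewrite normE (eqP x_root) mulr0 addr0 mulf_eq0 (negPf y_neq0) => /eqP.
move=> /norm0 m_eq /norm0 m'_eq.
have two_neq0 : 2%:R != 0 :> 'F_p.
  by rewrite -(dvdn_pcharf (pchar_Fp pr_p)) gtnNdvd // ltnW // split_prime_gt3.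
have x_neq0 : x%:R != 0 :> 'F_p.
  by apply: contraTneq x_root => ->; rewrite expr0n add0r oner_eq0.
have : 2%:R * x%:R * (m%:~R - m'%:~R) = 0 :> 'F_p.
  transitivity ((y%:R + 2%:R * m%:~R * x%:R) -
                (y%:R + 2%:R * m'%:~R * x%:R) : 'F_p).
    by ring.
  by rewrite m_eq m'_eq subr0.
by move/eqP; rewrite !mulf_eq0 (negPf two_neq0) (negPf x_neq0).
Qed.

Lemma coprimez_sqr1 (y x : nat) :
  coprime y (x ^ 2 + 1) -> coprimez y (x%:Z ^+ 2 + 1).
Proof.
have absE : absz (x%:Z ^+ 2 + 1) = (x ^ 2 + 1)%N by lia.
by rewrite coprimezE absE.
Qed.

(** * Bad windows on a line *)

Section Lines.
Variable R : realType.
Variables (P x y : nat).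
Hypothesis P_gt1 : (1 < P)%N.
Hypothesis x_odd : odd x.
Hypothesis x_split :
  forall p, split_prime p -> (p <= P)%N -> (p %| x ^ 2 + 1)%N.
Hypothesis y_co : coprime y (x ^ 2 + 1).
Hypothesis y_ndvd : forall p, prime p -> (p <= P)%N -> ~~ (p %| y)%N.

Let co_yx := coprimez_sqr1 y_co.

Let x_gt0 : 0 < x%:Z.
Proof. by case: x x_odd. Qed.

Lemma nth_window k n i : (i < n)%N ->
  (mkseq (fun i => alpha (@line R y x) (k + i)) n)`_i =
  alpha (@line R y x) (k + i).
Proof. by move=> lt_in; rewrite nth_mkseq. Qed.

(** The class chosen for [p] is that of any index in the window at which [p] divides the norm;
    [norm_divisor_class] puts all such indices into it. *)
Lemma bad_window_cover n :
  has_bad_window (@line R y x) n -> (n <= P)%N ->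
  exists r, split_cover n r.
Proof.
have [c0 alphaE] := @alpha_line R y x x_gt0.
move=> [k bad] n_le; pose m i : int := c0 + (k + i)%:Z.
have /choice[r r_class] : forall p, exists r : nat, forall i,
    (i < n)%N -> split_prime p -> (p <= P)%N -> (p %| point_norm y x (m i))%Z ->
    i == r %[mod p].
  move=> p; have [[r [r_lt r_dvd]]|none] :=
    pselect (exists r, (r < n)%N /\ (p %| point_norm y x (m r))%Z).
    exists r => i i_lt p_split p_le i_dvd.
    have pr_p : prime p by case/andP: p_split.
    have := norm_divisor_class p_split (x_split p_split p_le)
              (y_ndvd pr_p p_le) i_dvd r_dvd.
    have -> : m i - m r = i%:Z - r%:Z by rewrite /m; lia.
    by rewrite -eqz_mod_dvd !modz_nat eqz_nat.
  by exists 0%N => i i_lt _ _ i_dvd; case: none; exists i.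
exists r => i i_lt; have [] := bad i; first by rewrite size_mkseq.
move=> j []; rewrite size_mkseq => j_lt j_neq; rewrite !nth_window // !alphaE.
have neq_m : m i != m j by rewrite /m; apply/eqP; lia.
case/(common_divisor_prime co_yx neq_m) => p [pr_p p_ij p_i _].
have p_lt : (p < n)%N.
  apply: leq_ltn_trans (_ : absz (m i - m j) < n)%N; last by rewrite /m; lia.
  by apply: dvdn_leq; [rewrite absz_gt0 subr_eq0 | rewrite dvdzE in p_ij].
have p_le : (p <= P)%N by rewrite ltnW ?(leq_trans p_lt).
have y_odd : odd y by rewrite -[odd y]negbK -dvdn2 y_ndvd.
have p_split := norm_divisor_split pr_p x_odd y_odd (y_ndvd pr_p p_le) p_i.
by exists p; rewrite p_split p_lt r_class.
Qed.

Lemma bad_window_exists M :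
  (forall lo, exists2 c : nat, (lo <= c)%N &
    forall f : int, (`|f| <= M)%N ->
      exists p (f' : int), [/\ prime p, (`|f'| <= M)%N, f' != f,
        (p %| f' - f)%Z & (p %| point_norm y x (c%:Z + f))%Z]) ->
  has_bad_window (@line R y x) (2 * M + 1).
Proof.
have [c0 alphaE] := @alpha_line R y x x_gt0.
move=> /(_ (M + absz c0)%N)[c c_ge c_bad].
have k_ge0 : 0 <= c%:Z - M%:Z - c0 by lia.
(* The window covers the indices from [c - M] to [c + M]. Its start is counted from [c0], the index
   of [alpha0], and must not be negative. *)
exists (absz (c%:Z - M%:Z - c0)%R) => i; rewrite size_mkseq => i_lt.
have [|p [f [pr_p f_le f_neq p_f p_norm]]] := c_bad (i%:Z - M%:Z); first by lia.
have j_lt : (absz (f + M%:Z)%R < 2 * M + 1)%N by lia.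
exists (absz (f + M%:Z)%R); split=> //; first by lia.
rewrite !nth_window // !alphaE; apply: (@prime_common_divisor R y x _ _ p) => //.
  by apply: etrans p_f; congr (_ %| _)%Z; lia.
by apply: etrans p_norm; congr (_ %| point_norm _ _ _)%Z; lia.
Qed.

(** The given bad window shows that the minimum in [gL] is attained, so [gL] is itself the length of
    a bad window and not the default 0. *)
Lemma gL_ge M :
  (forall n r, (0 < n < P)%N -> ~ split_cover n r) ->
  (0 < M)%N -> has_bad_window (@line R y x) (2 * M + 1) ->
  (P <= gL (@line R y x))%N.
Proof.
move=> no_cover M_gt0 bad_M.
pose Q n := `[< (2 <= n)%N /\ has_bad_window (@line R y x) n >].
have Q_ex : exists n, Q n.
  by exists (2 * M + 1)%N; apply/asboolP; split=> //; lia.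
have gL_spec : exists n, [set n | [/\ (2 <= n)%N, has_bad_window (@line R y x) n
    & forall m, (2 <= m)%N -> has_bad_window (@line R y x) m -> (n <= m)%N]] n.
  case: (ex_minnP Q_ex) => n /asboolP[n_ge2 n_bad] n_min.
  by exists n; split=> // m m_ge2 m_bad; apply: n_min; apply/asboolP.
case: gL_spec => n /(xgetI 0%N) [gL_ge2 gL_bad _].
rewrite leqNgt; apply/negP => gL_lt.
have [r r_cover] := bad_window_cover gL_bad (ltnW gL_lt).
by apply: no_cover r_cover; rewrite gL_lt andbT (leq_trans _ gL_ge2).
Qed.

End Lines.

(** * Infinitely many lines *)

Lemma line_inj (R : realType) (x : int) : injective ((@line R)^~ x).
Proof.
move=> y y' line_eq; have : @line R y x (@gint R y 0).
  by rewrite /line /= mulr0 addr0.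
by rewrite [@line R y x]line_eq /line /= mulr0 addr0 => /intr_inj.
Qed.

(** For fixed [x], distinct [y] give distinct lines, so a finite set of lines would bound the
    admissible [y]. *)
Lemma infinite_large_gL (R : realType) P : (1 < P)%N ->
  (forall n r, (0 < n < P)%N -> ~ split_cover n r) ->
  infinite_set [set L : set R[i] | primitive_gaussian_line L /\ (P <= gL L)%N].
Proof.
move=> P_gt1 no_cover.
have [x [M [x_odd M_ge5 x_split lines]]] := line_parameters P_gt1.
pose f (y : nat) := @line R y x.
have f_inj : injective f by move=> y y' /line_inj [].
move=> /(@finite_preimage _ _ _ f) fin.
have /finite_fsetP[Y Y_eq] := fin (fun _ _ _ _ => @f_inj _ _).
have [y [y_ge y_co y_ndvd y_bad]] := lines (\max_(i <- Y) i).+1.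
have : y \in Y.
  have : [set` Y] y; last by [].
  rewrite -Y_eq; split.
    exact: primitive_line (coprimez_sqr1 y_co).
  apply: (@gL_ge R P x y P_gt1 x_odd x_split y_co y_ndvd M) => //.
    by rewrite (leq_trans _ M_ge5).
  exact: bad_window_exists.
move=> y_in; have : (y <= \max_(i <- Y) i)%N.
  exact: (leq_bigmax_seq (F := id)).
by rewrite leqNgt y_ge.
Qed.

Theorem theorem7 (R : realType) :
  infinite_set [set L : set R[i] |
    primitive_gaussian_line L /\ (260000 <= gL L)%N].
Proof.
apply: infinite_large_gL; last exact: no_single_class_cover.
by rewrite nat_260000.
Qed.
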